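(* The following hold. (1) Let $(\theta,\eta)$ be a $(\Pi^1_1,\Sigma^1_0)$-representation (i.e. an $\mathcal{L}_2$ representation of a Weihrauch problem with $\theta\in\Pi^1_1$ and $\eta$ arithmetical). If there is an $\mathcal{L}_2$-theory $T$ such that $T\subseteq\{\sigma:\text{every }\omega\text{-model of }\mathbf{ATR}_0\text{ satisfies }\sigma\}$ and $T\vdash\mathcal{L}_2(\theta,\eta)$, then $\mathrm{Pb}(\theta,\eta)\leq_W(\mathrm{Pb}(\theta,\eta))^{\mathrm{rfn}}\leq_W\mathsf{ATR}_2^{\mathrm{rfn}}$. (2) $\mathsf{ATR}_2^{\mathrm{rfn}}<_W\mathsf{C}_{\omega^\omega}$.
   Context: A (Weihrauch) problem is a partial function $\mathsf{P}$ from $\mathcal{P}(\omega)$ to $\mathcal{P}(\mathcal{P}(\omega))$ with nonempty domain; for $X\in\mathrm{dom}(\mathsf{P})$ (an input) the elements of $\mathsf{P}(X)$ are its outputs. Numbers, functions, tuples and sequences of sets are identified with subsets of $\omega$ via canonical computable bijections. $\mathsf{P}\leq_W\mathsf{Q}$ means there are computable functionals $\Phi,\Psi$ such that for all $X\in\mathrm{dom}(\mathsf{P})$, $\Phi(X)$ is defined and in $\mathrm{dom}(\mathsf{Q})$, and for all $Y\in\mathsf{Q}(\Phi(X))$, $\Psi(X,Y)$ is defined and in $\mathsf{P}(X)$. $\mathsf{P}<_W\mathsf{Q}$ means $\mathsf{P}\leq_W\mathsf{Q}$ and $\mathsf{Q}\not\leq_W\mathsf{P}$. $\mathcal{L}_2$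 is the language of second-order arithmetic; $\Sigma^1_0$ is the class of arithmetical formulas. An $\mathcal{L}_2$ representation of a problem is a pair $(\theta(X),\eta(X,Y))$ of $\mathcal{L}_2$-formulas such that, in $(\omega,\mathcal{P}(\omega))$, some $X$ satisfies $\theta$ and every $X$ with $\theta(X)$ has some $Y$ with $\eta(X,Y)$. Then $\mathrm{Pb}(\theta,\eta)$ is the problem with domain $\{X:\theta(X)\}$ and $\mathrm{Pb}(\theta,\eta)(X)=\{Y:\eta(X,Y)\}$, and $\mathcal{L}_2(\theta,\eta)$ is the sentence $\forall X(\theta(X)\to\exists Y\,\eta(X,Y))$. An $\omega$-model is an $\mathcal{L}_2$-structure $(\omega,S)$ with $S\subseteq\mathcal{P}(\omega)$. $\mathbf{ATR}_0$ is $\mathbf{RCA}_0$ plus: for every well-order $W$ and set $A$ there is a jump hierarchy of $(W,A)$. For a linear order $L\subseteq\omega^2$ with field $|L|$ and a set $A$, a jump hierarchy of $(L,A)$ is a sequence $\langle X_i\rangle_{i\in|L|}$ with $X_i=A$ if $i=\min_L$ and $X_i=(\langle X_j\rangle_{j<_L i})'$ otherwise ($'$ is the Turing jump). $\mathsf{ATR}_2$: an input is a linear order $L$ and a set $A$; an output is a jump hierarchy of $(L,A)$ or an infinite descending sequence of $L$. $\mathsf{C}_{\omega^\omega}$: an input is an ill-founded tree $T\subseteq\omega^{<\omega}$; an output is a path of $T$. An effective $\omega$-model of $\mathbf{ACA}_0$ is a triple $(\langle M_i\rangle_{i\in\omega},f,g)$ with $M_i\subseteq\omega$, $f:\omega\to\omega$,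 $g:\omega^2\to\omega$ such that $\{M_i:i\in\omega\}$ is closed downward under $\leq_T$, $M_{f(i)}=(M_i)'$ and $M_{g(i,j)}=M_i\oplus M_j$ for all $i,j$. For a problem $\mathsf{P}$, the $\omega$-model reflection $\mathsf{P}^{\mathrm{rfn}}$ is the problem whose inputs are all sets $X$ and whose outputs on $X$ are the tuples $(\langle M_i\rangle_i,f,g,e)$ such that $(\langle M_i\rangle_i,f,g)$ is an effective $\omega$-model of $\mathbf{ACA}_0$, $M_e=X$, and $\forall i(M_i\in\mathrm{dom}\,\mathsf{P}\to\exists j(M_j\in\mathsf{P}(M_i)))$. *)

(* Defs.v *)
From Stdlib Require List Cantor.
From mathcomp Require Import all_boot.
From mathcomp Require Import boolp classical_sets.
Set Implicit Arguments. Unset Strict Implicit. Unset Printing Implicit Defensive.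
Local Open Scope classical_set_scope.

Definition npair (a b : nat) : nat := Cantor.to_nat (a, b).
Definition nfst (n : nat) : nat := (Cantor.of_nat n).1.
Definition nsnd (n : nat) : nat := (Cantor.of_nat n).2.

Definition join (X Y : set nat) : set nat :=
  [set n | if odd n then Y n./2 else X n./2].

Definition column (Z : set nat) (i : nat) : set nat := [set n | Z (npair i n)].

Definition seq_set (M : nat -> set nat) : set nat :=
  [set z | M (nfst z) (nsnd z)].

Definition graph (f : nat -> nat) : set nat :=
  [set z | f (nfst z) = nsnd z].

Definition graph2 (g : nat -> nat -> nat) : set nat :=
  graph (fun z => g (nfst z) (nsnd z)).

(* Programs denote partial functions from numbers to numbers; several arguments
   are passed as iterated pairs. *)
Inductive code : Type :=
| CZero | CSucc | CFst | CSnd | COracle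
| CPair of code & code
| CComp of code & code
| CPrec of code & code
| CMu of code.

Fixpoint prec_rel (base : nat -> Prop) (step : nat -> nat -> nat -> Prop)
    (k m : nat) : Prop :=
  if k is k'.+1 then exists r, prec_rel base step k' r /\ step k' r m
  else base m.

(* [eval A c n m]: the program [c] with oracle [A] halts on [n] with value [m].
   [CPrec] recurses on the second component of its argument, and [CMu c] sends
   [n] to the least [m] with [c (n, m) = 0], all earlier values being defined. *)
Fixpoint eval (A : set nat) (c : code) (n m : nat) {struct c} : Prop :=
  match c with
  | CZero => m = 0
  | CSucc => m = n.+1
  | CFst => m = nfst n
  | CSnd => m = nsnd n
  | COracle => (A n /\ m = 1) \/ (~ A n /\ m = 0)
  | CPair c1 c2 =>
      exists a b, [/\ eval A c1 n a, eval A c2 n b & m = npair a b]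
  | CComp c1 c2 => exists a, eval A c2 n a /\ eval A c1 a m
  | CPrec c1 c2 =>
      prec_rel (fun r => eval A c1 (nfst n) r)
               (fun k r s => eval A c2 (npair (nfst n) (npair k r)) s)
               (nsnd n) m
  | CMu c1 =>
      eval A c1 (npair n m) 0 /\
      forall j, j < m -> exists r, eval A c1 (npair n j) r.+1
  end.

(* The functional with program [c] is defined at [X], with value [Y]. *)
Definition computes (c : code) (X Y : set nat) : Prop :=
  forall n, (Y n -> eval X c n 1) /\ (~ Y n -> eval X c n 0).

Definition turing_le (Y X : set nat) : Prop := exists c, computes c X Y.

(* Goedel numbering; a number outside its range is the index of the nowhere
   defined function. *)
Fixpoint index_of (c : code) : nat :=
  match c with
  | CZero => npair 0 0
  | CSucc => npair 1 0
  | CFst => npair 2 0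
  | CSnd => npair 3 0
  | COracle => npair 4 0
  | CPair c1 c2 => npair 5 (npair (index_of c1) (index_of c2))
  | CComp c1 c2 => npair 6 (npair (index_of c1) (index_of c2))
  | CPrec c1 c2 => npair 7 (npair (index_of c1) (index_of c2))
  | CMu c1 => npair 8 (index_of c1)
  end.

Definition jump (A : set nat) : set nat :=
  [set e | exists c m, index_of c = e /\ eval A c e m].

(* [out X] is only meaningful for [X] in [dom]. *)
Record problem : Type := Problem {
  dom : set (set nat);
  out : set nat -> set (set nat);
  dom_nonempty : dom !=set0 }.

Definition weihrauch_le (P Q : problem) : Prop :=
  exists c d : code, forall X, dom P X ->
    exists Z, [/\ computes c X Z, dom Q Z &
      forall Y, out Q Z Y -> exists V, computes d (join X Y) V /\ out P X V].

Definition weihrauch_lt (P Q : problem) : Prop :=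
  weihrauch_le P Q /\ ~ weihrauch_le Q P.

(* An order is the set of (coded) pairs of its reflexive relation. *)
Definition ord_le (L : set nat) (i j : nat) : Prop := L (npair i j).
Definition ord_lt (L : set nat) (i j : nat) : Prop := ord_le L i j /\ i <> j.
Definition field (L : set nat) : set nat :=
  [set i | exists j, ord_le L i j \/ ord_le L j i].

Definition linear_order (L : set nat) : Prop :=
  [/\ forall i, field L i -> ord_le L i i,
      forall i j, ord_le L i j -> ord_le L j i -> i = j,
      forall i j k, ord_le L i j -> ord_le L j k -> ord_le L i k &
      forall i j, field L i -> field L j -> ord_le L i j \/ ord_le L j i].

Definition is_min (L : set nat) (i : nat) : Prop :=
  field L i /\ forall j, field L j -> ord_le L i j.

Definition descending (L : set nat) (f : nat -> nat) : Prop :=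
  forall n, ord_lt L (f n.+1) (f n).

(* The sequence <H_j>_(j <_L i), coded as a set. *)
Definition below (L H : set nat) (i : nat) : set nat :=
  [set z | H z /\ ord_lt L (nfst z) i].

(* [H] codes a sequence indexed by [field L]: it is the set of all pairs (i, n)
   with i in [field L] and n in the i-th term. *)
Definition jump_hierarchy (L A H : set nat) : Prop :=
  (forall z, H z -> field L (nfst z)) /\
  (forall i, field L i ->
     (is_min L i -> column H i = A) /\
     (~ is_min L i -> column H i = jump (below L H i))).

Lemma linear_order0 : linear_order set0.
Proof. by split=> [i [j []]|i j []|i j k []|i j [k []]]. Qed.

Definition ATR2_dom : set (set nat) :=
  [set Z | exists L A, Z = join L A /\ linear_order L].

Definition ATR2_out (Z : set nat) : set (set nat) :=
  [set Y | exists L A, Z = join L A /\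
     (jump_hierarchy L A Y \/ exists f, Y = graph f /\ descending L f)].

Lemma ATR2_dom_nonempty : ATR2_dom !=set0.
Proof. by exists (join set0 set0), set0, set0; split=> //; exact: linear_order0. Qed.

Definition ATR2 : problem := @Problem ATR2_dom ATR2_out ATR2_dom_nonempty.

(* [CodeSeq.code] is a computable bijection from finite sequences to numbers. *)
Definition is_tree (T : set nat) : Prop :=
  forall s t : seq nat, T (CodeSeq.code (s ++ t)) -> T (CodeSeq.code s).

Definition is_path (T : set nat) (f : nat -> nat) : Prop :=
  forall n, T (CodeSeq.code (mkseq f n)).

Definition CBaire_dom : set (set nat) :=
  [set T | is_tree T /\ exists f, is_path T f].

Definition CBaire_out (T : set nat) : set (set nat) :=
  [set Y | exists f, Y = graph f /\ is_path T f].

Lemma CBaire_dom_nonempty : CBaire_dom !=set0.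
Proof. by exists setT; split=> //; exists id. Qed.

Definition CBaire : problem :=
  @Problem CBaire_dom CBaire_out CBaire_dom_nonempty.

Definition effective_ACA0_model
    (M : nat -> set nat) (f : nat -> nat) (g : nat -> nat -> nat) : Prop :=
  [/\ forall i (Y : set nat), turing_le Y (M i) -> exists j, M j = Y,
      forall i, M (f i) = jump (M i) &
      forall i j, M (g i j) = join (M i) (M j)].

Definition tuple4 (M : nat -> set nat) (f : nat -> nat) (g : nat -> nat -> nat)
    (e : nat) : set nat :=
  join (seq_set M) (join (graph f) (join (graph2 g) [set e])).

Definition rfn_out (P : problem) (X : set nat) : set (set nat) :=
  [set Y | exists M f g e,
     [/\ Y = tuple4 M f g e, effective_ACA0_model M f g, M e = X &
         forall i, dom P (M i) -> exists j, out P (M i) (M j)]].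

Lemma rfn_dom_nonempty : (@setT (set nat)) !=set0.
Proof. by exists set0. Qed.

Definition rfn (P : problem) : problem :=
  @Problem setT (rfn_out P) rfn_dom_nonempty.

(* De Bruijn indices, counted separately for number and for set variables. *)
Inductive term : Type :=
| TVar of nat | TZero | TOne
| TAdd of term & term
| TMul of term & term.

Inductive formula : Type :=
| FEq of term & term
| FLt of term & term
| FMem of term & nat
| FBot
| FImp of formula & formula
| FAnd of formula & formula
| FOr of formula & formula
| FAllN of formula
| FExN of formula
| FAllS of formula
| FExS of formula.

Definition FNot (p : formula) := FImp p FBot.
Definition FIff (p q : formula) := FAnd (FImp p q) (FImp q p).

Definition scons (T : Type) (x : T) (r : nat -> T) (n : nat) : T :=
  if n is k.+1 then r k else x.

(* The free number variables are < [a] and the free set variables are < [b]. *)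
Fixpoint term_bound (a : nat) (t : term) : Prop :=
  match t with
  | TVar i => i < a
  | TZero | TOne => True
  | TAdd s t | TMul s t => term_bound a s /\ term_bound a t
  end.

Fixpoint free_bound (a b : nat) (p : formula) : Prop :=
  match p with
  | FEq s t | FLt s t => term_bound a s /\ term_bound a t
  | FMem t X => term_bound a t /\ X < b
  | FBot => True
  | FImp p q | FAnd p q | FOr p q => free_bound a b p /\ free_bound a b q
  | FAllN p | FExN p => free_bound a.+1 b p
  | FAllS p | FExS p => free_bound a b.+1 p
  end.

Definition sentence (p : formula) : Prop := free_bound 0 0 p.

Fixpoint tsubst (s : nat -> term) (t : term) : term :=
  match t with
  | TVar i => s i
  | TZero => TZero
  | TOne => TOne
  | TAdd u v => TAdd (tsubst s u) (tsubst s v)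
  | TMul u v => TMul (tsubst s u) (tsubst s v)
  end.

Definition tshift : term -> term := tsubst (fun i => TVar i.+1).

(* Number variables are replaced by terms, set variables are renamed. *)
Fixpoint subst (s : nat -> term) (r : nat -> nat) (p : formula) : formula :=
  match p with
  | FEq u v => FEq (tsubst s u) (tsubst s v)
  | FLt u v => FLt (tsubst s u) (tsubst s v)
  | FMem u X => FMem (tsubst s u) (r X)
  | FBot => FBot
  | FImp p q => FImp (subst s r p) (subst s r q)
  | FAnd p q => FAnd (subst s r p) (subst s r q)
  | FOr p q => FOr (subst s r p) (subst s r q)
  | FAllN p => FAllN (subst (scons (TVar 0) (tshift \o s)) r p)
  | FExN p => FExN (subst (scons (TVar 0) (tshift \o s)) r p)
  | FAllS p => FAllS (subst s (scons 0 (succn \o r)) p)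
  | FExS p => FExS (subst s (scons 0 (succn \o r)) p)
  end.

Definition shiftN (p : formula) := subst (fun i => TVar i.+1) id p.
Definition shiftS (p : formula) := subst TVar succn p.
Definition instN (t : term) (p : formula) := subst (scons t TVar) id p.
Definition instS (X : nat) (p : formula) := subst TVar (scons X id) p.

Fixpoint arithmetical (p : formula) : Prop :=
  match p with
  | FEq _ _ | FLt _ _ | FMem _ _ | FBot => True
  | FImp p q | FAnd p q | FOr p q => arithmetical p /\ arithmetical q
  | FAllN p | FExN p => arithmetical p
  | FAllS _ | FExS _ => False
  end.

(* A possibly empty block of universal set quantifiers before an arithmetical
   formula. *)
Inductive Pi11 : formula -> Prop :=
| Pi11_arith p : arithmetical p -> Pi11 p
| Pi11_all p : Pi11 p -> Pi11 (FAllS p).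

Inductive Delta00 : formula -> Prop :=
| D00_eq s t : Delta00 (FEq s t)
| D00_lt s t : Delta00 (FLt s t)
| D00_mem t X : Delta00 (FMem t X)
| D00_bot : Delta00 FBot
| D00_imp p q : Delta00 p -> Delta00 q -> Delta00 (FImp p q)
| D00_and p q : Delta00 p -> Delta00 q -> Delta00 (FAnd p q)
| D00_or p q : Delta00 p -> Delta00 q -> Delta00 (FOr p q)
| D00_all t p : Delta00 p -> Delta00 (FAllN (FImp (FLt (TVar 0) (tshift t)) p))
| D00_ex t p : Delta00 p -> Delta00 (FExN (FAnd (FLt (TVar 0) (tshift t)) p)).

Inductive Sigma01 : formula -> Prop :=
| Sigma01_ex p : Delta00 p -> Sigma01 (FExN p).

Inductive Pi01 : formula -> Prop :=
| Pi01_all p : Delta00 p -> Pi01 (FAllN p).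

(* Classical natural deduction, with equality on numbers only. *)
Inductive derives : seq formula -> formula -> Prop :=
| Dhyp G p : List.In p G -> derives G p
| Draa G p : derives (FNot p :: G) FBot -> derives G p
| DimpI G p q : derives (p :: G) q -> derives G (FImp p q)
| DimpE G p q : derives G (FImp p q) -> derives G p -> derives G q
| DandI G p q : derives G p -> derives G q -> derives G (FAnd p q)
| DandE1 G p q : derives G (FAnd p q) -> derives G p
| DandE2 G p q : derives G (FAnd p q) -> derives G q
| DorI1 G p q : derives G p -> derives G (FOr p q)
| DorI2 G p q : derives G q -> derives G (FOr p q)
| DorE G p q r : derives G (FOr p q) ->
    derives (p :: G) r -> derives (q :: G) r -> derives G r
| DallNI G p : derives (map shiftN G) p -> derives G (FAllN p)
| DallNE G p t : derives G (FAllN p) -> derives G (instN t p)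
| DexNI G p t : derives G (instN t p) -> derives G (FExN p)
| DexNE G p q : derives G (FExN p) ->
    derives (p :: map shiftN G) (shiftN q) -> derives G q
| DallSI G p : derives (map shiftS G) p -> derives G (FAllS p)
| DallSE G p X : derives G (FAllS p) -> derives G (instS X p)
| DexSI G p X : derives G (instS X p) -> derives G (FExS p)
| DexSE G p q : derives G (FExS p) ->
    derives (p :: map shiftS G) (shiftS q) -> derives G q
| DeqI G t : derives G (FEq t t)
| DeqE G p s t : derives G (FEq s t) ->
    derives G (instN s p) -> derives G (instN t p).

Definition proves (T : set formula) (p : formula) : Prop :=
  exists G : seq formula, (forall q, List.In q G -> T q) /\ derives G p.

Fixpoint teval (v : nat -> nat) (t : term) : nat :=
  match t with
  | TVar i => v i
  | TZero => 0
  | TOne => 1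
  | TAdd s t => teval v s + teval v t
  | TMul s t => teval v s * teval v t
  end.

(* Satisfaction in (omega, S) under the assignments [v] and [V]. *)
Fixpoint sat (S : set (set nat)) (v : nat -> nat) (V : nat -> set nat)
    (p : formula) : Prop :=
  match p with
  | FEq s t => teval v s = teval v t
  | FLt s t => teval v s < teval v t
  | FMem t X => V X (teval v t)
  | FBot => False
  | FImp p q => sat S v V p -> sat S v V q
  | FAnd p q => sat S v V p /\ sat S v V q
  | FOr p q => sat S v V p \/ sat S v V q
  | FAllN p => forall n, sat S (scons n v) V p
  | FExN p => exists n, sat S (scons n v) V p
  | FAllS p => forall X, S X -> sat S v (scons X V) p
  | FExS p => exists X, S X /\ sat S v (scons X V) p
  end.

(* Truth of the universal closure of [p] in (omega, S), for [S] nonempty. *)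
Definition models (S : set (set nat)) (p : formula) : Prop :=
  forall v V, (forall i, S (V i)) -> sat S v V p.

Definition FSucc (t : term) := TAdd t TOne.

(* The universal closures of these formulas are the axioms. *)
Inductive RCA0 : formula -> Prop :=
| RCA0_succ0 : RCA0 (FNot (FEq (FSucc (TVar 0)) TZero))
| RCA0_succI :
    RCA0 (FImp (FEq (FSucc (TVar 0)) (FSucc (TVar 1))) (FEq (TVar 0) (TVar 1)))
| RCA0_add0 : RCA0 (FEq (TAdd (TVar 0) TZero) (TVar 0))
| RCA0_addS :
    RCA0 (FEq (TAdd (TVar 0) (FSucc (TVar 1))) (FSucc (TAdd (TVar 0) (TVar 1))))
| RCA0_mul0 : RCA0 (FEq (TMul (TVar 0) TZero) TZero)
| RCA0_mulS :
    RCA0 (FEq (TMul (TVar 0) (FSucc (TVar 1)))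
              (TAdd (TMul (TVar 0) (TVar 1)) (TVar 0)))
| RCA0_lt0 : RCA0 (FNot (FLt (TVar 0) TZero))
| RCA0_ltS :
    RCA0 (FIff (FLt (TVar 0) (FSucc (TVar 1)))
               (FOr (FLt (TVar 0) (TVar 1)) (FEq (TVar 0) (TVar 1))))
| RCA0_induction p : Sigma01 p ->
    RCA0 (FImp (FAnd (instN TZero p)
                 (FAllN (FImp p
                   (subst (scons (FSucc (TVar 0)) (fun i => TVar i.+1)) id p))))
               (FAllN p))
| RCA0_comprehension p q : Sigma01 p -> Pi01 q ->
    RCA0 (FImp (FAllN (FIff p q))
               (FExS (FAllN (FIff (FMem (TVar 0) 0) (shiftS p))))).

Definition well_order_in (S : set (set nat)) (W : set nat) : Prop :=
  linear_order W /\ ~ exists f, S (graph f) /\ descending W f.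

(* The last clause is the meaning in (omega, S) of the axiom on jump hierarchies;
   [linear_order] and [jump_hierarchy] are arithmetical, hence absolute. *)
Definition omega_model_ATR0 (S : set (set nat)) : Prop :=
  [/\ S !=set0,
      forall p, RCA0 p -> models S p &
      forall W A, S W -> S A -> well_order_in S W ->
        exists H, S H /\ jump_hierarchy W A H].

(* In [theta] the variable X is the set variable 0; in [eta] the variables Y and
   X are the set variables 0 and 1. *)
Definition repr_dom (theta : formula) : set (set nat) :=
  [set X | sat setT (fun=> 0) (scons X (fun=> set0)) theta].

Definition repr_out (eta : formula) (X : set nat) : set (set nat) :=
  [set Y | sat setT (fun=> 0) (scons Y (scons X (fun=> set0))) eta].

Record representation (theta eta : formula) : Prop := Representation {
  theta_free : free_bound 0 1 theta;
  eta_free : free_bound 0 2 eta;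
  repr_dom_nonempty : repr_dom theta !=set0;
  repr_total : forall X, repr_dom theta X -> exists Y, repr_out eta X Y }.

Definition Pb (theta eta : formula) (h : representation theta eta) : problem :=
  @Problem (repr_dom theta) (repr_out eta) (repr_dom_nonempty h).

Definition L2_sentence (theta eta : formula) : formula :=
  FAllS (FImp theta (FExS eta)).

(* Main.v *)
Require Import Defs.
From mathcomp Require Import all_boot.
From mathcomp Require Import boolp classical_sets zify.

(** For the first part, let an output of [rfn ATR2] be given.  Its model satisfies
    ATR_0 ([members_ATR0]), hence by soundness ([derives_sound]) the sentence of the
    representation.  Since a true Pi^1_1 hypothesis remains true in the model and an
    arithmetical conclusion is absolute, the model also reflects the represented
    problem, so the reduction does not change the output ([rfn_Pb_le]).  The
    reduction of a problem to its own reflection must find a member of the model that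
    solves the instance.  This is a search with a decidable test, because the code
    of an effective model computes all finite jumps of the members and so decides all
    their arithmetical properties ([arith_dec], [ucomp_em_arith], [le_rfn]).

    For the second part, call a problem arithmetical if its instances and solutions
    are.  [ATR2] is arithmetical, and so is the reflection of an arithmetical problem
    ([arith_rfn]).  The point is that evaluation of programs with an oracle is
    arithmetical ([arith_eval_index]).  Every arithmetical problem with solutions for
    all instances reduces to choice on Baire space ([arith_problem_le_CBaire]): the
    pairs of a solution and a truth table witnessing its correctness are the paths of
    a tree computable from the instance.  In particular this holds for [rfn ATR2] and
    also for [rfn (rfn ATR2)].  On the other hand, no arithmetical problem with
    solutions for all instances bounds its own reflection ([rfn_not_le]), by an
    incompleteness argument in the style of Yablo's paradox.  Were choice on Baire
    space below [rfn ATR2], then [rfn (rfn ATR2)] would be too, a contradiction. *)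

Set Implicit Arguments. Unset Strict Implicit. Unset Printing Implicit Defensive.
Local Open Scope classical_set_scope.

(** * Programs *)

Lemma nfst_npair a b : nfst (npair a b) = a.
Proof. by rewrite /nfst /npair Cantor.cancel_of_to. Qed.

Lemma nsnd_npair a b : nsnd (npair a b) = b.
Proof. by rewrite /nsnd /npair Cantor.cancel_of_to. Qed.

Lemma npair_eta n : npair (nfst n) (nsnd n) = n.
Proof. by rewrite /npair /nfst /nsnd -surjective_pairing Cantor.cancel_to_of. Qed.

Lemma leq_npair a b : a + b <= npair a b.
Proof. by rewrite addnC; apply/leP; exact: Cantor.to_nat_non_decreasing. Qed.

(* From here on the pairing is used only through these facts; unfolding it would
   make unification diverge. *)
#[local] Opaque npair nfst nsnd.

Definition npE := (nfst_npair, nsnd_npair, npair_eta).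

Lemma npair_inj a b c d : npair a b = npair c d -> a = c /\ b = d.
Proof. by move=> e; rewrite -(nfst_npair a b) -{2}(nsnd_npair a b) e !npE. Qed.

Lemma index_of_inj : injective index_of.
Proof.
elim=> [||||| a IHa b IHb| a IHa b IHb| a IHa b IHb| a IHa]
  [||||| c d| c d| c d| c] //= /npair_inj[] //.
- by move=> _ /npair_inj[/IHa-> /IHb->].
- by move=> _ /npair_inj[/IHa-> /IHb->].
- by move=> _ /npair_inj[/IHa-> /IHb->].
- by move=> _ /IHa->.
Qed.

Lemma eval_fun A c n m m' : eval A c n m -> eval A c n m' -> m = m'.
Proof.
elim: c n m m' => /= [|||||a IHa b IHb|a IHa b IHb|a IHa b IHb|a IHa] n m m'.
- by move=> -> ->.
- by move=> -> ->.
- by move=> -> ->.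
- by move=> -> ->.
- by move=> [[? ->]|[? ->]] [[? ->]|[? ->]].
- by move=> [x [y [hx hy ->]]] [x' [y' [/(IHa _ _ _ hx)<- /(IHb _ _ _ hy)<- ->]]].
- by move=> [x [hx hm]] [x' [/(IHb _ _ _ hx)<- /(IHa _ _ _ hm)]].
- elim: (nsnd n) m m' => [|k IHk] m m' /=; first exact: IHa.
  by move=> [r [/IHk hr hm]] [r' [/hr<- /(IHb _ _ _ hm)]].
- move=> [h0 hlt] [h0' hlt']; case: (ltngtP m m') => // lt_m.
    by have [r /(IHa _ _ _ h0)] := hlt' _ lt_m.
  by have [r /(IHa _ _ _ h0')] := hlt _ lt_m.
Qed.

Definition chi (A : set nat) (n : nat) : nat := `[< A n >].

Lemma chi1 A n : A n -> chi A n = 1. Proof. by rewrite /chi => /asboolT->. Qed.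
Lemma chi0 A n : ~ A n -> chi A n = 0. Proof. by rewrite /chi => /asboolF->. Qed.

Lemma chi_eq0 A n : (chi A n == 0) = ~~ `[< A n >].
Proof. by rewrite /chi; case: asbool. Qed.

Lemma computesP c X Y : computes c X Y <-> forall n, eval X c n (chi Y n).
Proof.
split=> [h n|h n].
  have [h1 h0] := h n; have [/[dup] /h1 ? /chi1->//|/[dup] /h0 ? /chi0->//] := pselect (Y n).
by split=> [/chi1|/chi0] e; move: (h n); rewrite e.
Qed.

Lemma computes_set c X Y : computes c X Y -> Y = [set n | eval X c n 1].
Proof.
move=> h; rewrite predeqE => n; split=> [/(proj1 (h n))//|h1].
by apply: contrapT => nY; have := eval_fun h1 (proj2 (h n) nY).
Qed.

Definition CId := CPair CFst CSnd.

Lemma eval_id A n : eval A CId n n.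
Proof. by exists (nfst n), (nsnd n); rewrite npE. Qed.

(** If [d] computes the characteristic function of the set [B_p] uniformly in
    [p], then [psub d c] runs [c] with oracle [B_p]; the parameter is carried
    along as the first component of every argument. *)
Fixpoint psub (d c : code) : code :=
  match c with
  | CZero => CZero
  | CSucc => CComp CSucc CSnd
  | CFst => CComp CFst CSnd
  | CSnd => CComp CSnd CSnd
  | COracle => d
  | CPair a b => CPair (psub d a) (psub d b)
  | CComp a b => CComp (psub d a) (CPair CFst (psub d b))
  | CPrec a b =>
      CComp (CPrec (psub d a)
                   (CComp (psub d b)
                          (CPair (CComp CFst CFst)
                                 (CPair (CComp CSnd CFst) CSnd))))
            (CPair (CPair CFst (CComp CFst CSnd)) (CComp CSnd CSnd))
  | CMu a => CMu (CComp (psub d a)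
                        (CPair (CComp CFst CFst) (CPair (CComp CSnd CFst) CSnd)))
  end.

Lemma eval_reassoc A p n m :
  eval A (CPair (CComp CFst CFst) (CPair (CComp CSnd CFst) CSnd))
       (npair (npair p n) m) (npair p (npair n m)).
Proof.
exists p, (npair n m); split=> //=; first by exists (npair p n); rewrite !npE.
by exists n, m; split=> //; [exists (npair p n); rewrite !npE | rewrite !npE].
Qed.

Lemma eval_psub A B d p :
  (forall x, eval A d (npair p x) (chi B x)) ->
  forall c n m, eval B c n m -> eval A (psub d c) (npair p n) m.
Proof.
move=> dB; elim=> [|||||a IHa b IHb|a IHa b IHb|a IHa b IHb|a IHa] n m.
- by [].
- by move=> /= ->; exists n; rewrite !npE.
- by move=> /= ->; exists n; rewrite !npE.
- by move=> /= ->; exists n; rewrite !npE.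
- by move=> /= [[/chi1<- ->]|[/chi0<- ->]].
- by move=> [x [y [/IHa hx /IHb hy ->]]]; exists x, y.
- move=> [x [/IHb hx /IHa hm]]; exists (npair p x); split=> //.
  by exists p, x; split=> //=; rewrite npE.
- rewrite -{1 2}(npair_eta n) => h.
  exists (npair (npair p (nfst n)) (nsnd n)); split.
    exists (npair p (nfst n)), (nsnd n); split=> //=.
      exists p, (nfst n); split=> //=; first by rewrite npE.
      by exists n; rewrite !npE.
    by exists n; rewrite !npE.
  move: h => /=; rewrite !npE; elim: (nsnd n) m => [|k IHk] m /=; first exact: IHa.
  move=> [r [hr hm]]; exists r; split; first exact: IHk.
  by exists (npair p (npair (nfst n) (npair k r))); split; [exact: eval_reassoc|exact: IHb].
- move=> [h0 hlt]; split.
    by exists (npair p (npair n m)); split; [exact: eval_reassoc|exact: IHa].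
  move=> j /hlt[r hr]; exists r.
  by exists (npair p (npair n j)); split; [exact: eval_reassoc|exact: IHa].
Qed.

(** Families of total functions computed by one program: the index [i] stands for
    whatever data the oracle [O i] encodes, and the program must not depend on it. *)
Definition ucomp (I : Type) (O : I -> set nat) (F : I -> nat -> nat) : Prop :=
  exists c, forall i n, eval (O i) c n (F i n).

Section Ucomp.
Variables (I : Type) (O : I -> set nat).
Implicit Types (F G H : I -> nat -> nat) (b : I -> nat -> bool).
Local Notation uc := (ucomp O).

Lemma ucomp_ext F G : (forall i n, F i n = G i n) -> uc F -> uc G.
Proof. by move=> e [c h]; exists c => i n; rewrite -e. Qed.

Lemma ucomp_id : uc (fun _ n => n).
Proof. by exists CId => i n; exact: eval_id. Qed.

Lemma ucomp_app F G : uc F -> uc G -> uc (fun i n => F i (G i n)).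
Proof. by move=> [c hc] [d hd]; exists (CComp c d) => i n; exists (G i n). Qed.

Lemma ucomp_succ F : uc F -> uc (fun i n => (F i n).+1).
Proof. by apply: (@ucomp_app (fun _ => succn)); exists CSucc. Qed.

Lemma ucomp_const k : uc (fun _ _ => k).
Proof. by elim: k => [|k /ucomp_succ//]; exists CZero. Qed.

Lemma ucomp_fst F : uc F -> uc (fun i n => nfst (F i n)).
Proof. by apply: (@ucomp_app (fun _ => nfst)); exists CFst. Qed.

Lemma ucomp_snd F : uc F -> uc (fun i n => nsnd (F i n)).
Proof. by apply: (@ucomp_app (fun _ => nsnd)); exists CSnd. Qed.

Lemma ucomp_pair F G : uc F -> uc G -> uc (fun i n => npair (F i n) (G i n)).
Proof.
by move=> [c hc] [d hd]; exists (CPair c d) => i n; exists (F i n), (G i n).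
Qed.

Lemma ucomp_oracle F : uc F -> uc (fun i n => chi (O i) (F i n)).
Proof.
apply: (@ucomp_app (fun i => chi (O i))); exists COracle => i n /=.
by have [/[dup] ? /chi1->|/[dup] ? /chi0->] := pselect (O i n); [left|right].
Qed.

(** Two-argument functions are handled through the pairing, so that a family
    already known to be computable can be applied to computed arguments. *)
Lemma ucomp_app2 (H : I -> nat -> nat -> nat) F G :
  uc (fun i z => H i (nfst z) (nsnd z)) -> uc F -> uc G ->
  uc (fun i n => H i (F i n) (G i n)).
Proof.
move=> hH hF hG; have := ucomp_app hH (ucomp_pair hF hG).
by apply: ucomp_ext => i n; rewrite !npE.
Qed.

Lemma ucomp_iteri (S : I -> nat -> nat -> nat -> nat) F G :
  uc (fun i z => S i (nfst z) (nfst (nsnd z)) (nsnd (nsnd z))) ->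
  uc F -> uc G ->
  uc (fun i n => iteri (G i n) (S i n) (F i n)).
Proof.
move=> [c hc] [d hd] hG.
have : uc (fun i z => iteri (nsnd z) (S i (nfst z)) (F i (nfst z))).
  exists (CPrec d c) => i z /=; elim: (nsnd z) => [|k IHk] /=; first exact: hd.
  eexists; split; first exact: IHk.
  by move: (hc i (npair (nfst z) (npair k (iteri k (S i (nfst z)) (F i (nfst z))))));
    rewrite !npE.
by move=> h; apply: ucomp_ext (ucomp_app h (ucomp_pair ucomp_id hG)) => i n; rewrite !npE.
Qed.

Lemma ucomp_mu (H : I -> nat -> nat -> nat) G :
  uc (fun i z => H i (nfst z) (nsnd z)) ->
  (forall i n, H i n (G i n) = 0) ->
  (forall i n j, j < G i n -> H i n j <> 0) -> uc G.
Proof.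
move=> [c hc] h0 hlt; exists (CMu c) => i n; split.
  by move: (hc i (npair n (G i n))); rewrite !npE h0.
move=> j /hlt; move: (hc i (npair n j)); rewrite !npE.
by case: (H i n j) => // r h _; exists r.
Qed.

Lemma ucomp_if b F G : uc (fun i n => b i n) -> uc F -> uc G ->
  uc (fun i n => if b i n then F i n else G i n).
Proof.
move=> hb hF hG.
have h : uc (fun i n => iteri (b i n) (fun _ _ => F i n) (G i n)).
  apply: (@ucomp_iteri (fun i n _ _ => F i n)) => //.
  exact: ucomp_app hF (ucomp_fst ucomp_id).
by apply: ucomp_ext h => i n; case: (b _ _).
Qed.

Lemma ucomp_add F G : uc F -> uc G -> uc (fun i n => F i n + G i n).
Proof.
move=> hF hG; have h : uc (fun i n => iteri (G i n) (fun _ r => r.+1) (F i n)).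
  by apply: (@ucomp_iteri (fun i n _ r => r.+1)) => //; apply: ucomp_succ; do 2!apply: ucomp_snd; exact: ucomp_id.
by apply: ucomp_ext h => i n; elim: (G i n) => [|k /= ->]; rewrite ?addn0 ?addnS.
Qed.

Lemma ucomp_mul F G : uc F -> uc G -> uc (fun i n => F i n * G i n).
Proof.
move=> hF hG; have h : uc (fun i n => iteri (G i n) (fun _ r => r + F i n) 0).
  apply: (@ucomp_iteri (fun i n _ r => r + F i n)) => //; last exact: ucomp_const.
  apply: ucomp_add; first by apply: ucomp_snd; apply: ucomp_snd; exact: ucomp_id.
  exact: ucomp_app hF (ucomp_fst ucomp_id).
by apply: ucomp_ext h => i n; elim: (G i n) => [|k /= ->]; rewrite ?muln0 // mulnS addnC.
Qed.

Lemma ucomp_pred F : uc F -> uc (fun i n => (F i n).-1).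
Proof.
move=> hF; have h : uc (fun i n => iteri (F i n) (fun k _ => k) 0).
  apply: (@ucomp_iteri (fun _ _ k _ => k)) => //; last exact: ucomp_const.
  by apply: ucomp_fst; apply: ucomp_snd; exact: ucomp_id.
by apply: ucomp_ext h => i n; case: (F i n).
Qed.

Lemma ucomp_sub F G : uc F -> uc G -> uc (fun i n => F i n - G i n).
Proof.
move=> hF hG; have h : uc (fun i n => iteri (G i n) (fun _ r => r.-1) (F i n)).
  by apply: (@ucomp_iteri (fun _ _ _ r => r.-1)) => //; apply: ucomp_pred; do 2!apply: ucomp_snd; exact: ucomp_id.
by apply: ucomp_ext h => i n; elim: (G i n) => [|k /= ->]; rewrite ?subn0 ?subnS.
Qed.

Lemma ucomp_leq F G : uc F -> uc G -> uc (fun i n => F i n <= G i n).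
Proof.
move=> hF hG; have h : uc (fun i n => 1 - (F i n - G i n)).
  exact: ucomp_sub (ucomp_const 1) (ucomp_sub hF hG).
by apply: ucomp_ext h => i n; rewrite /leq; case: (F i n - G i n).
Qed.

Lemma ucomp_negb b : uc (fun i n => b i n) -> uc (fun i n => ~~ b i n).
Proof.
by move=> h; apply: ucomp_ext (ucomp_sub (ucomp_const 1) h) => i n; case: (b _ _).
Qed.

Lemma ucomp_andb b b' : uc (fun i n => b i n) -> uc (fun i n => b' i n) ->
  uc (fun i n => b i n && b' i n).
Proof. by move=> h h'; apply: ucomp_ext (ucomp_mul h h') => i n; case: (b _ _); case: (b' _ _). Qed.

Lemma ucomp_orb b b' : uc (fun i n => b i n) -> uc (fun i n => b' i n) ->
  uc (fun i n => b i n || b' i n).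
Proof.
move=> h h'; apply: ucomp_ext (ucomp_negb (ucomp_andb (ucomp_negb h) (ucomp_negb h'))).
by move=> i n; case: (b _ _); case: (b' _ _).
Qed.

Lemma ucomp_implyb b b' : uc (fun i n => b i n) -> uc (fun i n => b' i n) ->
  uc (fun i n => b i n ==> b' i n).
Proof.
move=> h h'; apply: ucomp_ext (ucomp_orb (ucomp_negb h) h').
by move=> i n; case: (b _ _); case: (b' _ _).
Qed.

Lemma ucomp_eq F G : uc F -> uc G -> uc (fun i n => F i n == G i n).
Proof.
move=> hF hG; apply: ucomp_ext (ucomp_andb (ucomp_leq hF hG) (ucomp_leq hG hF)).
by move=> i n; rewrite eqn_leq.
Qed.

Lemma ucomp_eqb b b' : uc (fun i n => b i n) -> uc (fun i n => b' i n) ->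
  uc (fun i n => b i n == b' i n).
Proof. by move=> h h'; apply: ucomp_ext (ucomp_eq h h') => i n; case: (b _ _); case: (b' _ _). Qed.

Lemma ucomp_odd F : uc F -> uc (fun i n => odd (F i n)).
Proof.
move=> hF; have h : uc (fun i n => iteri (F i n) (fun _ r => r == 0 : nat) 0).
  apply: (@ucomp_iteri (fun _ _ _ r => r == 0)) => //; last exact: ucomp_const.
  by apply: ucomp_eq (ucomp_const 0); do 2!apply: ucomp_snd; exact: ucomp_id.
by apply: ucomp_ext h => i n; elim: (F i n) => [|k /= ->] //; case: odd.
Qed.

Lemma ucomp_half F : uc F -> uc (fun i n => (F i n)./2).
Proof.
move=> hF; have h : uc (fun i n => iteri (F i n) (fun k r => r + odd k) 0).
  apply: (@ucomp_iteri (fun _ _ k r => r + odd k)) => //; last exact: ucomp_const.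
  apply: ucomp_add; first by do 2!apply: ucomp_snd; exact: ucomp_id.
  by apply: ucomp_odd; apply: ucomp_fst; apply: ucomp_snd; exact: ucomp_id.
apply: ucomp_ext h => i n; elim: (F i n) => [|k /= ->] //.
by rewrite uphalf_half addnC.
Qed.

Lemma ucomp_double F : uc F -> uc (fun i n => (F i n).*2).
Proof. by move=> h; apply: ucomp_ext (ucomp_add h h) => i n; rewrite addnn. Qed.

Lemma ucomp_all (p : I -> nat -> nat -> bool) F :
  uc (fun i z => p i (nfst z) (nsnd z)) -> uc F ->
  uc (fun i n => all (p i n) (iota 0 (F i n))).
Proof.
move=> hp hF.
have h : uc (fun i n => iteri (F i n) (fun k r => (r != 0) && p i n k : nat) 1).
  apply: (@ucomp_iteri (fun i n k r => (r != 0) && p i n k)) => //; last exact: ucomp_const.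
  apply: ucomp_andb.
    by apply: ucomp_negb; apply: ucomp_eq (ucomp_const 0); do 2!apply: ucomp_snd; exact: ucomp_id.
  exact: (ucomp_app2 (H := fun i n k => p i n k) hp (ucomp_fst ucomp_id) (ucomp_fst (ucomp_snd ucomp_id))).
apply: ucomp_ext h => i n; elim: (F i n) => [//|k IHk].
by rewrite [LHS]/= IHk -addn1 iotaD all_cat /= andbT; case: all.
Qed.

Lemma ucomp_iter (S : I -> nat -> nat -> nat) F G :
  uc (fun i z => S i (nfst z) (nsnd z)) -> uc F -> uc G ->
  uc (fun i n => iter (G i n) (S i n) (F i n)).
Proof.
move=> hS hF hG; have h : uc (fun i n => iteri (G i n) (fun _ => S i n) (F i n)).
  apply: (@ucomp_iteri (fun i n _ r => S i n r)) => //.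
  exact: (ucomp_app2 hS (ucomp_fst ucomp_id) (ucomp_snd (ucomp_snd ucomp_id))).
by apply: ucomp_ext h => i n; elim: (G i n) => [|k /= ->].
Qed.

Lemma ucomp_ifb b b1 b2 : uc (fun i n => b i n) -> uc (fun i n => b1 i n) ->
  uc (fun i n => b2 i n) -> uc (fun i n => if b i n then b1 i n else b2 i n).
Proof.
by move=> h h1 h2; apply: ucomp_ext (ucomp_if h h1 h2) => i n; case: (b _ _).
Qed.

(** Finite sets of numbers are coded by the binary digits of a number. *)
Definition bit (D x : nat) : bool := odd (iter x half D).

Lemma ucomp_bit F G : uc F -> uc G -> uc (fun i n => bit (F i n) (G i n)).
Proof.
move=> hF hG; apply: ucomp_odd; apply: (@ucomp_iter (fun _ _ => half)) => //.
by apply: ucomp_half; apply: ucomp_snd; exact: ucomp_id.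
Qed.

End Ucomp.

(** A program for a [J]-indexed family runs on oracles computed from [O i]: the
    oracle may depend on the first component of the input. *)
Lemma ucomp_subst (I J : Type) (O : I -> set nat) (O' : J -> set nat)
    (s : I -> nat -> J) (F : J -> nat -> nat) :
  ucomp O' F ->
  ucomp O (fun i z => chi (O' (s i (nfst z))) (nsnd z)) ->
  ucomp O (fun i z => F (s i (nfst z)) (nsnd z)).
Proof.
move=> [c hc] [d hd]; exists (psub d c) => i z; rewrite -{1}(npair_eta z).
by apply: eval_psub (hc _ _) => x; move: (hd i (npair (nfst z) x)); rewrite !npE.
Qed.

Definition computable (h : nat -> nat) : Prop :=
  ucomp (fun A : set nat => A) (fun _ => h).

Lemma ucomp_computable I (O : I -> set nat) h F :
  computable h -> ucomp O F -> ucomp O (fun i n => h (F i n)).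
Proof. by move=> [c hc]; apply: (@ucomp_app _ _ (fun _ => h)); exists c => i n; exact: hc. Qed.

Lemma computableP I (O : I -> set nat) h : computable h -> ucomp O (fun _ => h).
Proof. by move=> [c hc]; exists c. Qed.

(** Follows the structure of the expression that defines the family. *)
Ltac uc := cbv beta; repeat lazymatch goal with
  | |- ucomp _ (fun _ n => n) => exact: ucomp_id
  | |- ucomp _ (fun _ n => npair _ _) => apply: ucomp_pair
  | |- ucomp _ (fun _ n => nfst _) => apply: ucomp_fst
  | |- ucomp _ (fun _ n => nsnd _) => apply: ucomp_snd
  | |- ucomp _ (fun _ => id) => exact: ucomp_id
  | |- ucomp _ (fun _ => npair ?a) => exact: (ucomp_pair (@ucomp_const _ _ a) (@ucomp_id _ _))
  | |- ucomp _ (fun _ => nfst) => exact: (ucomp_fst (@ucomp_id _ _))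
  | |- ucomp _ (fun _ => nsnd) => exact: (ucomp_snd (@ucomp_id _ _))
  | |- ucomp _ (fun _ n => half _) => apply: ucomp_half
  | |- ucomp _ (fun _ n => double _) => apply: ucomp_double
  | |- ucomp _ (fun _ n => _ + _) => apply: ucomp_add
  | |- ucomp _ (fun _ n => _ * _) => apply: ucomp_mul
  | |- ucomp _ (fun _ n => _ - _) => apply: ucomp_sub
  | |- ucomp _ (fun _ n => nat_of_bool (~~ _)) => apply: ucomp_negb
  | |- ucomp _ (fun _ n => nat_of_bool (_ && _)) => apply: ucomp_andb
  | |- ucomp _ (fun _ n => nat_of_bool (_ || _)) => apply: ucomp_orb
  | |- ucomp _ (fun _ n => nat_of_bool (_ ==> _)) => apply: ucomp_implyb
  | |- ucomp _ (fun _ n => nat_of_bool (_ <= _)) => apply: ucomp_leq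
  | |- ucomp _ (fun _ n => nat_of_bool (@eq_op bool _ _)) => apply: ucomp_eqb
  | |- ucomp _ (fun _ n => nat_of_bool (@eq_op nat _ _)) => apply: ucomp_eq
  | |- ucomp _ (fun _ n => nat_of_bool (@eq_op _ _ _)) => first [apply: ucomp_eq | apply: ucomp_eqb]
  | |- ucomp _ (fun _ n => nat_of_bool (odd _)) => apply: ucomp_odd
  | |- ucomp _ (fun _ n => nat_of_bool (all _ _)) => apply: ucomp_all
  | |- ucomp _ (fun _ n => nat_of_bool (bit _ _)) => apply: ucomp_bit
  | |- ucomp _ (fun _ n => nat_of_bool (if _ then _ else _)) => apply: ucomp_ifb
  | |- ucomp _ (fun _ n => if _ then _ else _) => apply: ucomp_if
  | |- ucomp _ (fun _ n => S _) => first [exact: ucomp_const | apply: ucomp_succ]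
  | |- ucomp _ (fun _ n => Nat.pred _) => apply: ucomp_pred
  | |- ucomp _ (fun _ n => chi _ _) =>
      first [apply: ucomp_oracle | (apply: ucomp_computable; first eassumption)]
  | |- _ => first [exact: ucomp_const | assumption
                  | (apply: ucomp_computable; first assumption)]
  end.

(** Functionals compose: [psub] is used here with the constant parameter 0. *)
Definition csub (c d : code) : code := CComp (psub (CComp d CSnd) c) (CPair CZero CId).

Lemma csubP c d X Y Z : computes d X Y -> computes c Y Z -> computes (csub c d) X Z.
Proof.
move=> /computesP hd /computesP hc; apply/computesP => n.
exists (npair 0 n); split.
  by exists 0, n; split=> //; exact: eval_id.
apply: eval_psub (hc n) => x; exists x; split=> //=; by rewrite npE.
Qed.

Lemma turing_le_trans X Y Z : turing_le X Y -> turing_le Y Z -> turing_le X Z.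
Proof. by move=> [c hc] [d hd]; exists (csub c d); exact: csubP hd hc. Qed.

Lemma join_even X Y n : join X Y n.*2 = X n.
Proof. by rewrite /join /= odd_double doubleK. Qed.

Lemma join_odd X Y n : join X Y n.*2.+1 = Y n.
Proof. by rewrite /join /= odd_double /= uphalf_double. Qed.

Lemma join_inj X Y X' Y' : join X Y = join X' Y' -> X = X' /\ Y = Y'.
Proof.
move=> e; split; rewrite predeqE => n.
  by rewrite -(join_even X Y) e join_even.
by rewrite -(join_odd X Y) e join_odd.
Qed.

Lemma ucomp_computes I (O : I -> set nat) (Y : I -> set nat) :
  ucomp O (fun i n => chi (Y i) n) <-> exists c, forall i, computes c (O i) (Y i).
Proof.
by split=> [[c h]|[c h]]; exists c => i; [apply/computesP => n; exact: h|exact: (proj1 (computesP _ _ _) (h i))].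
Qed.

Lemma computes_left : exists c, forall X Y, computes c (join X Y) X.
Proof.
have [|c hc] := proj1 (@ucomp_computes _ (fun p => join p.1 p.2) (fun p : set nat * set nat => p.1)).
  apply: (@ucomp_ext _ _ (fun p n => chi (join p.1 p.2) n.*2)); last by uc.
  by move=> p n; rewrite /chi join_even.
by exists c => X Y; exact: (hc (X, Y)).
Qed.

Lemma computes_right : exists c, forall X Y, computes c (join X Y) Y.
Proof.
have [|c hc] := proj1 (@ucomp_computes _ (fun p => join p.1 p.2) (fun p : set nat * set nat => p.2)).
  apply: (@ucomp_ext _ _ (fun p n => chi (join p.1 p.2) n.*2.+1)); last by uc.
  by move=> p n; rewrite /chi join_odd.
by exists c => X Y; exact: (hc (X, Y)).
Qed.

Lemma computes_join c d : exists e, forall W X Y,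
  computes c W X -> computes d W Y -> computes e W (join X Y).
Proof.
pose J := {p : set nat * set nat * set nat | computes c p.1.1 p.1.2 /\ computes d p.1.1 p.2}.
have [|e he] := proj1 (@ucomp_computes J (fun p => (sval p).1.1) (fun p => join (sval p).1.2 (sval p).2)).
  pose F (p : J) n := if odd n then chi (sval p).2 n./2 else chi (sval p).1.2 n./2.
  apply: (@ucomp_ext _ _ F).
    by move=> p n; rewrite /F /chi /join /=; case: odd.
  have h1 : ucomp (fun p : J => (sval p).1.1) (fun p n => chi (sval p).1.2 n).
    by exists c => -[[[W X] Y] /= [h1 h2]] n; exact: (proj1 (computesP _ _ _) h1).
  have h2 : ucomp (fun p : J => (sval p).1.1) (fun p n => chi (sval p).2 n).
    by exists d => -[[[W X] Y] /= [h1' h2]] n; exact: (proj1 (computesP _ _ _) h2).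
  rewrite /F; apply: ucomp_if; first by uc.
    by apply: (ucomp_app h2); uc.
  by apply: (ucomp_app h1); uc.
by exists e => W X Y hX hY; exact: (he (exist _ (W, X, Y) (conj hX hY))).
Qed.

(** * Arithmetical predicates *)

(** Predicates of a set and a number that are arithmetical, with few constructors
    so that the inductions below stay short.  Several number arguments are packed
    into one by pairing, several set arguments by [join] or by columns. *)
Inductive arith : (set nat -> nat -> Prop) -> Prop :=
| arith_mem h : computable h -> arith (fun A n => A (h n))
| arith_eq0 h : computable h -> arith (fun _ n => h n = 0)
| arith_imp P Q : arith P -> arith Q -> arith (fun A n => P A n -> Q A n)
| arith_all0 P : arith P -> arith (fun A n => forall k, P A (npair k n)).

Lemma arith_ext P Q : arith P -> (forall A n, P A n <-> Q A n) -> arith Q.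
Proof.
by move=> hP e; suff <- : P = Q by []; apply/funext => A; apply/funext => n; apply/propext.
Qed.

Lemma arith_reindex P h : arith P -> computable h -> arith (fun A n => P A (h n)).
Proof.
move=> hP; elim: hP h => [g hg|g hg|{}P Q _ IHP _ IHQ|{}P _ IHP] h hh.
- by apply: arith_mem; apply: ucomp_computable.
- by apply: arith_eq0; apply: ucomp_computable.
- by apply: arith_imp; [exact: IHP|exact: IHQ].
- have /IHP/arith_all0 : computable (fun z => npair (nfst z) (h (nsnd z))).
    by rewrite /computable; uc.
  by move/arith_ext; apply=> A n; split=> H k; move: (H k); rewrite !npE.
Qed.

Lemma arith_false : arith (fun _ _ => False).
Proof.
have h : computable (fun=> 1) by exact: ucomp_const.
by apply: (arith_ext (arith_eq0 h)) => A n; split.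
Qed.

Lemma arith_not P : arith P -> arith (fun A n => ~ P A n).
Proof. by move=> hP; exact: arith_imp hP arith_false. Qed.

Lemma arith_true : arith (fun _ _ => True).
Proof. by apply: arith_ext (arith_not arith_false) _ => A n; split=> // _ []. Qed.

Lemma arith_and P Q : arith P -> arith Q -> arith (fun A n => P A n /\ Q A n).
Proof.
move=> hP hQ; apply: arith_ext (arith_not (arith_imp hP (arith_not hQ))) _ => A n.
split=> [h|[p q] h]; last exact: h.
by split; apply: contrapT => nh; apply: h.
Qed.

Lemma arith_and3 P Q R : arith P -> arith Q -> arith R ->
  arith (fun A n => [/\ P A n, Q A n & R A n]).
Proof.
move=> hP hQ hR; apply: arith_ext (arith_and hP (arith_and hQ hR)) _ => A n.
by split=> [[? []]|[]].
Qed.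

Lemma arith_and4 P Q R S : arith P -> arith Q -> arith R -> arith S ->
  arith (fun A n => [/\ P A n, Q A n, R A n & S A n]).
Proof.
move=> hP hQ hR hS; apply: arith_ext (arith_and hP (arith_and3 hQ hR hS)) _ => A n.
by split=> [[? []]|[]].
Qed.

Lemma arith_or P Q : arith P -> arith Q -> arith (fun A n => P A n \/ Q A n).
Proof.
move=> hP hQ; apply: arith_ext (arith_imp (arith_not hP) hQ) _ => A n.
split=> [h|[p|q]//]; by have [|/h] := pselect (P A n); [left|right].
Qed.

Lemma arith_iff P Q : arith P -> arith Q -> arith (fun A n => P A n <-> Q A n).
Proof. by move=> hP hQ; apply: arith_and; apply: arith_imp. Qed.

Lemma arith_all P : arith (fun A z => P A (nfst z) (nsnd z)) ->
  arith (fun A n => forall k, P A k n).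
Proof.
move/arith_all0/arith_ext; apply=> A n.
by split=> h k; move: (h k); rewrite !npE.
Qed.

Lemma arith_ex P : arith (fun A z => P A (nfst z) (nsnd z)) ->
  arith (fun A n => exists k, P A k n).
Proof.
move=> /arith_not hP; apply: arith_ext (arith_not (arith_all (P := fun A k n => ~ P A k n) hP)) _.
move=> A n; split=> [h|[k Pk] h]; last exact: h k Pk.
by apply: contrapT => nex; apply: h => k Pk; apply: nex; exists k.
Qed.

Lemma arith_bool (b : nat -> bool) : computable (fun n => b n) -> arith (fun _ n => b n).
Proof.
move=> hb; apply: (@arith_ext (fun _ n => ~~ b n = 0 :> nat)).
  by apply: arith_eq0; apply: ucomp_negb.
by move=> A n; case: (b n).
Qed.

Lemma arith_eq a b : computable a -> computable b -> arith (fun _ n => a n = b n).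
Proof.
move=> ha hb; apply: arith_ext (arith_bool (b := fun n => a n == b n) _) _.
  exact: ucomp_eq.
by move=> _ n; split=> /eqP.
Qed.

Lemma arith_if (b : nat -> bool) P Q : computable (fun n => b n) -> arith P -> arith Q ->
  arith (fun A n => if b n then P A n else Q A n).
Proof.
move=> /[dup] /arith_bool hb _ hP hQ.
apply: arith_ext (arith_and (arith_imp hb hP) (arith_imp (arith_not hb) hQ)) _.
by move=> A n; case: (b n); split=> [[h1 h2]|h]; do ?split=> //; [exact: h1|exact: h2].
Qed.

(** This is what allows a predicate of one set to be applied to the members, joins
    and sections of sets coded in the argument [A]: in the induction on [R], only
    the membership atom changes, into an instance of the definition of [Q]. *)
Lemma arith_in R (Q : set nat -> nat -> set nat) h :
  arith R -> arith (fun A z => Q A (nfst z) (nsnd z)) -> computable h ->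
  arith (fun A n => R (Q A n) (h n)).
Proof.
move=> hR hQ hh.
suff {h hh} H : arith (fun A z => R (Q A (nfst z)) (nsnd z)).
  have : computable (fun n => npair n (h n)) by rewrite /computable; uc.
  by move=> /(arith_reindex H)/arith_ext; apply=> A n; rewrite !npE.
elim: hR => [g hg|g hg|P P' _ IH _ IH'|P _ IH].
- have : computable (fun z => npair (nfst z) (g (nsnd z))) by rewrite /computable; uc.
  by move=> /(arith_reindex hQ)/arith_ext; apply=> A z; rewrite !npE.
- by apply: (arith_eq0 (h := fun z => g (nsnd z))); rewrite /computable; uc.
- exact: arith_imp.
- apply: arith_all.
  have : computable (fun z => npair (nfst (nsnd z)) (npair (nfst z) (nsnd (nsnd z)))).
    by rewrite /computable; uc.
  by move=> /(arith_reindex IH)/arith_ext; apply=> A z; rewrite !npE.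
Qed.

Lemma arith_seteq (Q1 Q2 : set nat -> nat -> set nat) :
  arith (fun A z => Q1 A (nfst z) (nsnd z)) ->
  arith (fun A z => Q2 A (nfst z) (nsnd z)) ->
  arith (fun A n => Q1 A n = Q2 A n).
Proof.
move=> h1 h2; apply: arith_ext (arith_all (P := fun A k n => Q1 A n k <-> Q2 A n k) _) _.
  have sw : computable (fun z => npair (nsnd z) (nfst z)) by rewrite /computable; uc.
  apply: arith_iff.
    by apply: arith_ext (arith_reindex h1 sw) _ => A z; rewrite !npE.
  by apply: arith_ext (arith_reindex h2 sw) _ => A z; rewrite !npE.
by move=> A n; rewrite predeqE.
Qed.

Ltac ucc := rewrite /computable; uc.

(** Follows the logical structure of the predicate down to its atoms. *)
Ltac ar := cbv beta delta [mkset]; repeat first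
  [ assumption
  | exact: arith_true | exact: arith_false
  | apply: arith_not | apply: arith_iff | apply: arith_and | apply: arith_and3 | apply: arith_and4 | apply: arith_or
  | apply: arith_ex | apply: arith_all | apply: arith_imp
  | (apply: arith_eq; [by ucc | by ucc])
  | (apply: arith_bool; by ucc)
  | (apply: arith_if; [by ucc | | ])
  | (apply: arith_mem; by ucc)
  | apply: arith_seteq ].

(** ** Deciding an arithmetical predicate from finitely many jumps *)

Fixpoint constc (k : nat) : code :=
  if k is k'.+1 then CComp CSucc (constc k') else CZero.

Lemma eval_constc A k n : eval A (constc k) n k.
Proof. by elim: k => [|k IH] //=; exists k. Qed.

Lemma ucomp_index_constc I (O : I -> set nat) F :
  ucomp O F -> ucomp O (fun i n => index_of (constc (F i n))).
Proof.
move=> hF; have h : ucomp O (fun i n => iteri (F i n)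
    (fun _ r => npair 6 (npair (index_of CSucc) r)) (index_of CZero)).
  by apply: (@ucomp_iteri _ _ (fun _ _ _ r => npair 6 (npair (index_of CSucc) r))); uc.
by apply: ucomp_ext h => i n; elim: (F i n) => [|k /= ->].
Qed.

Lemma halts_mu A c (F : nat -> nat) n : (forall z, eval A c z (F z)) ->
  (exists m, eval A (CMu c) n m) <-> exists m, F (npair n m) = 0.
Proof.
move=> hc; split=> [[m [h0 _]]|ex].
  by exists m; apply: eval_fun (hc _) h0.
have ex' : exists m, F (npair n m) == 0 by have [m /eqP] := ex; exists m.
case: (ex_minnP ex') => m /eqP m0 mmin.
exists m; split; first by rewrite -m0; exact: hc.
move=> j lt_jm; exists (F (npair n j)).-1; rewrite prednK; first exact: hc.
by rewrite lt0n; apply: contraL lt_jm => /mmin; rewrite -leqNgt.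
Qed.

Lemma jump_index A c : jump A (index_of c) <-> exists m, eval A c (index_of c) m.
Proof. by split=> [[d [m [/index_of_inj->]]]|[m h]]; [exists m|exists c, m]. Qed.

(** A computable question about the existence of a number is one question to the
    jump: the program that ignores its input and searches for this number has an
    index computable from the parameters. *)
Lemma ucomp_jump I (O : I -> set nat) (F : I -> nat -> nat -> nat) :
  ucomp O (fun i z => F i (nfst z) (nsnd z)) ->
  ucomp (fun i => jump (O i)) (fun i n => `[< exists m, F i m n = 0 >]).
Proof.
move=> [c hc].
pose q n := CMu (CComp c (CPair CSnd (constc n))).
have qP i n : jump (O i) (index_of (q n)) <-> exists m, F i m n = 0.
  rewrite jump_index (halts_mu (F := fun z => F i (nsnd z) n)) => [|z].
    by split=> -[m] e; exists m; move: e; rewrite npE.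
  exists (npair (nsnd z) n); split.
    by exists (nsnd z), n; split=> //=; exact: eval_constc.
  by move: (hc i (npair (nsnd z) n)); rewrite !npE.
apply: (@ucomp_ext _ _ (fun i n => chi (jump (O i)) (index_of (q n)))).
  by move=> i n; rewrite /chi; congr (nat_of_bool _); apply/asbool_equiv_eq.
apply: ucomp_oracle; apply: (@ucomp_ext _ _ (fun i n => npair 8 (npair 6
   (npair (index_of c) (npair 5 (npair (index_of CSnd) (index_of (constc n)))))))) => //.
by uc; apply: ucomp_index_constc; uc.
Qed.

Lemma ucomp_lift I (O : I -> set nat) F :
  ucomp O F -> ucomp (fun i => jump (O i)) F.
Proof.
move=> hF.
have h : ucomp (fun i => jump (O i)) (fun i n => chi (O i) n).
  have /(ucomp_jump (F := fun i _ n => 1 - chi (O i) n)) :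
    ucomp O (fun i z => 1 - chi (O i) (nsnd z)) by uc.
  apply: ucomp_ext => i n; rewrite /chi; congr (nat_of_bool _); apply/asbool_equiv_eq.
  have [h|h] := pselect (O i n); first by rewrite asboolT //; split=> // _; exists 0.
  by rewrite asboolF //; split=> // -[m].
have /(ucomp_subst (s := fun i _ => i) hF) H :
  ucomp (fun i => jump (O i)) (fun i z => chi (O i) (nsnd z)).
  by apply: (ucomp_app h); uc.
have := ucomp_app H (ucomp_pair (@ucomp_const _ _ 0) (@ucomp_id _ _)).
by apply: ucomp_ext => i n; rewrite !npE.
Qed.

Lemma ucomp_lift_iter I (O : I -> set nat) F k l :
  k <= l -> ucomp (fun i => iter k jump (O i)) F -> ucomp (fun i => iter l jump (O i)) F.
Proof.
by move=> /subnK<-; elim: (l - k) => [//|j IH] /IH /ucomp_lift.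
Qed.

Lemma ucomp_chi_imp I (O : I -> set nat) (P Q : I -> nat -> Prop) :
  ucomp O (fun i n => `[< P i n >]) -> ucomp O (fun i n => `[< Q i n >]) ->
  ucomp O (fun i n => `[< P i n -> Q i n >]).
Proof.
move=> hP hQ; apply: ucomp_ext (ucomp_implyb hP hQ) => i n.
by rewrite asbool_imply.
Qed.

(** Connectives cost no jump, because lower jumps are computable from higher ones
    uniformly; each universal quantifier costs one. *)
Lemma arith_dec R : arith R ->
  exists k, ucomp (fun A => iter k jump A) (fun A n => `[< R A n >]).
Proof.
elim=> [h hh|h hh|P Q _ [k hP] _ [l hQ]|P _ [k hP]].
- exists 0; apply: (@ucomp_ext _ _ (fun A n => chi A (h n))) => //=.
  by apply: ucomp_oracle; exact: computableP.
- exists 0; apply: (@ucomp_ext _ _ (fun A n => h n == 0)).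
    by move=> A n; congr (nat_of_bool _); apply/eqP/asboolP.
  by apply: ucomp_eq (@ucomp_const _ _ 0); exact: computableP.
- exists (maxn k l); apply: ucomp_chi_imp.
    exact: (ucomp_lift_iter (O := id) (leq_maxl _ _) hP).
  exact: (ucomp_lift_iter (O := id) (leq_maxr _ _) hQ).
- exists k.+1.
  have /(ucomp_jump (F := fun A m n => `[< P A (npair m n) >])) hj :
      ucomp (fun A => iter k jump A) (fun A z => `[< P A (npair (nfst z) (nsnd z)) >]).
    by apply: ucomp_ext hP => A z; rewrite npE.
  apply: ucomp_ext (ucomp_negb hj) => A n; congr (nat_of_bool _).
  rewrite -asbool_neg; apply/asbool_equiv_eq; split=> [h m|h [m]].
    by apply: contrapT => nP; apply: h; exists m; rewrite asboolF.
  by rewrite asboolT.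
Qed.

(** ** Evaluation of programs is arithmetical *)

Lemma ex_bits (s : seq nat) : exists D, forall x, bit D x = (x \in s).
Proof.
have pred_bits (p : pred nat) N : exists D, forall x, bit D x = (x < N) && p x.
  elim: N p => [|N IH] p.
    by exists 0 => x; rewrite /bit; elim: x => [//|x]; rewrite iterSr.
  have [D hD] := IH (p \o succn); exists (p 0 + D.*2) => -[|x].
    by rewrite /bit /= oddD odd_double addbF oddb.
  by rewrite /bit iterSr half_bit_double ltnS -hD.
have [D hD] := pred_bits (mem s) (sumn s).+1; exists D => x; rewrite hD ltnS.
rewrite -[mem s x]/(x \in s) andbC; case: (boolP (x \in s)) => //=.
elim: s {hD D} => [//|y s IH] /=; rewrite inE.
by case/orP=> [/eqP->|/IH h]; [rewrite leq_addr | apply: leq_trans h (leq_addl _ _)].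
Qed.

(** One step of the definition of [eval] on indices, the recursive calls being
    replaced by membership in [D]. *)
Definition justified (A : set nat) (D : nat -> nat -> nat -> Prop) (e n m : nat) : Prop :=
  if nfst e == 0 then m = 0
  else if nfst e == 1 then m = n.+1
  else if nfst e == 2 then m = nfst n
  else if nfst e == 3 then m = nsnd n
  else if nfst e == 4 then (A n /\ m = 1) \/ (~ A n /\ m = 0)
  else if nfst e == 5 then
    exists x y, [/\ D (nfst (nsnd e)) n x, D (nsnd (nsnd e)) n y & m = npair x y]
  else if nfst e == 6 then exists x, D (nsnd (nsnd e)) n x /\ D (nfst (nsnd e)) x m
  else if nfst e == 7 then
    (nsnd n = 0 /\ D (nfst (nsnd e)) (nfst n) m) \/
    exists k r, [/\ nsnd n = k.+1, D e (npair (nfst n) k) r &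
                    D (nsnd (nsnd e)) (npair (nfst n) (npair k r)) m]
  else D (nsnd e) (npair n m) 0 /\
    forall j, j < m -> exists r, D (nsnd e) (npair n j) r.+1.

Definition certifies A (s : nat -> bool) : Prop :=
  forall t, s t -> justified A (fun e n m => s (npair e (npair n m)))
                     (nfst t) (nfst (nsnd t)) (nsnd (nsnd t)).

Lemma justified_mono A (D D' : nat -> nat -> nat -> Prop) e n m :
  (forall e n m, D e n m -> D' e n m) -> justified A D e n m -> justified A D' e n m.
Proof.
move=> sub; rewrite /justified; do 5!case: ifP => _ //.
case: ifP => _; first by move=> [x [y [? ? ?]]]; exists x, y; split=> //; exact: sub.
case: ifP => _; first by move=> [x [? ?]]; exists x; split; exact: sub.
case: ifP => _; last by move=> [? h]; split; [exact: sub|move=> j /h[r ?]; exists r; exact: sub].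
by move=> [[? ?]|[k [r [? ? ?]]]]; [left; split=> //; exact: sub|right; exists k, r; split=> //; exact: sub].
Qed.

(** The induction is on the program, so [s] may be any set of triples, however
    circular. *)
Lemma certifies_sound A s c n m :
  certifies A s -> s (npair (index_of c) (npair n m)) -> eval A c n m.
Proof.
move=> cert; elim: c n m => [|||||a IHa b IHb|a IHa b IHb|a IHa b IHb|a IHa] n m.
- by move/cert; rewrite /justified /= !npE.
- by move/cert; rewrite /justified /= !npE.
- by move/cert; rewrite /justified /= !npE.
- by move/cert; rewrite /justified /= !npE.
- by move/cert; rewrite /justified /= !npE.
- move/cert; rewrite /justified /= !npE /= => -[x [y [/IHa hx /IHb hy ->]]].
  by exists x, y.
- by move/cert; rewrite /justified /= !npE /= => -[x [/IHb hx /IHa hm]]; exists x.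
- rewrite -[n]npair_eta /= !(nfst_npair, nsnd_npair); elim: (nsnd n) m => [|k IHk] m.
    by move/cert; rewrite /justified /= !(nfst_npair, nsnd_npair) /= => -[[_ /IHa//]|[k [r [//]]]].
  move/cert; rewrite /justified /= !(nfst_npair, nsnd_npair) /= => -[[//]|[_ [r [[<-] /IHk hr /IHb hm]]]].
  by exists r.
- move/cert; rewrite /justified /= !npE /= => -[/IHa h0 hlt]; split=> // j /hlt[r /IHa].
  by exists r.
Qed.

Lemma certifies_cat A (s1 s2 : seq nat) :
  certifies A (mem s1) -> certifies A (mem s2) -> certifies A (mem (s1 ++ s2)).
Proof.
move=> h1 h2 t; rewrite /= mem_cat => /orP[/h1|/h2]; apply: justified_mono => e n m /=;
  by rewrite mem_cat => ->; rewrite ?orbT.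
Qed.

Definition certified A t := exists2 s : seq nat, certifies A (mem s) & t \in s.

(** Certificates are closed under union, so finitely many facts share one. *)
Lemma certified_all A (l : seq nat) : (forall t, t \in l -> certified A t) ->
  exists2 s : seq nat, certifies A (mem s) & {subset l <= s}.
Proof.
elim: l => [|t l IH] h; first by exists [::].
have [|s cs ls] := IH; first by move=> u ul; apply: h; rewrite inE ul orbT.
have [s' cs' ts'] := h t (mem_head _ _).
exists (s' ++ s); first exact: certifies_cat.
by move=> u; rewrite inE mem_cat => /orP[/eqP->|/ls->]; rewrite ?ts' ?orbT.
Qed.

Lemma certified_step A e n m (l : seq nat) :
  (forall t, t \in l -> certified A t) ->
  justified A (fun e n m => npair e (npair n m) \in l) e n m ->
  certified A (npair e (npair n m)).
Proof.
move=> /certified_all[s cs ls] je; exists (npair e (npair n m) :: s); last exact: mem_head.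
move=> t; rewrite /= inE => /orP[/eqP->|/cs].
  rewrite !npE; apply: justified_mono je => x y z /ls.
  by rewrite inE => ->; rewrite orbT.
by apply: justified_mono => x y z /=; rewrite inE => ->; rewrite orbT.
Qed.

Lemma certified_eval A c n m : eval A c n m -> certified A (npair (index_of c) (npair n m)).
Proof.
elim: c n m => [|||||a IHa b IHb|a IHa b IHb|a IHa b IHb|a IHa] n m /=.
- by move=> ->; apply: (@certified_step _ _ _ _ [::]) => //; rewrite /justified !npE.
- by move=> ->; apply: (@certified_step _ _ _ _ [::]) => //; rewrite /justified !npE.
- by move=> ->; apply: (@certified_step _ _ _ _ [::]) => //; rewrite /justified !npE.
- by move=> ->; apply: (@certified_step _ _ _ _ [::]) => //; rewrite /justified !npE.
- by move=> h; apply: (@certified_step _ _ _ _ [::]) => //; rewrite /justified !npE.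
- move=> [x [y [/IHa hx /IHb hy ->]]].
  apply: (@certified_step _ _ _ _ [:: npair (index_of a) (npair n x);
                                      npair (index_of b) (npair n y)]).
    by move=> t; rewrite !inE => /orP[]/eqP->.
  by rewrite /justified !npE /=; exists x, y; rewrite !inE !eqxx orbT.
- move=> [x [/IHb hx /IHa hm]].
  apply: (@certified_step _ _ _ _ [:: npair (index_of b) (npair n x);
                                      npair (index_of a) (npair x m)]).
    by move=> t; rewrite !inE => /orP[]/eqP->.
  by rewrite /justified !npE /=; exists x; rewrite !inE !eqxx orbT.
- rewrite -[X in npair X m](npair_eta n); elim: (nsnd n) m => [|k IHk] m /=.
    move=> /IHa h; apply: (@certified_step _ _ _ _ [:: npair (index_of a) (npair (nfst n) m)]).
      by move=> t; rewrite !inE => /eqP->.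
    by rewrite /justified !npE /=; left; rewrite !inE.
  move=> [r [/IHk hr /IHb hm]].
  apply: (@certified_step _ _ _ _
    [:: npair (npair 7 (npair (index_of a) (index_of b))) (npair (npair (nfst n) k) r);
        npair (index_of b) (npair (npair (nfst n) (npair k r)) m)]).
    by move=> t; rewrite !inE => /orP[]/eqP->.
  by rewrite /justified !npE /=; right; exists k, r; rewrite !inE !eqxx orbT.
- move=> [/IHa h0 hlt].
  have [|r hr] := @choice _ _ (fun j r => j < m -> eval A a (npair n j) r.+1).
    move=> j.
    by have [/hlt[r]|] := boolP (j < m); [exists r|exists 0].
  apply: (@certified_step _ _ _ _ (npair (index_of a) (npair (npair n m) 0) ::
    [seq npair (index_of a) (npair (npair n j) (r j).+1) | j <- iota 0 m])).
    move=> t; rewrite inE => /orP[/eqP->//|/mapP[j]].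
    by rewrite mem_iota => /= /hr/IHa h ->.
  rewrite /justified !npE /= mem_head; split=> // j lt_jm; exists (r j).
  by rewrite inE; apply/orP; right; apply/mapP; exists j => //; rewrite mem_iota.
Qed.

(** A halting computation only involves finitely many smaller ones, and the finite
    set of all of them is a number: this makes evaluation arithmetical without a
    universal program. *)
Lemma evalP A c n m : eval A c n m <->
  exists D, bit D (npair (index_of c) (npair n m)) /\ certifies A (bit D).
Proof.
split=> [/certified_eval[s cs ts]|[D [hD cert]]]; last exact: certifies_sound cert hD.
have [D hD] := ex_bits s; exists D; rewrite hD; split=> //.
by move=> t; rewrite hD => /cs; apply: justified_mono => e k l; rewrite hD.
Qed.

(** Being an index needs its own certificates, finite sets closed under taking the
    indices of immediate subprograms: a certificate for an evaluation says nothing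
    about subprograms that are never run, such as the step of a recursion that
    stops at 0. *)
Definition index_step (s : nat -> bool) (e : nat) : bool :=
  if nfst e < 5 then nsnd e == 0
  else if nfst e < 8 then s (nfst (nsnd e)) && s (nsnd (nsnd e))
  else (nfst e == 8) && s (nsnd e).

Lemma indexP e : (exists c, index_of c = e) <->
  exists D, bit D e /\ forall x, bit D x -> index_step (bit D) x.
Proof.
split=> [[c <-]|[D [hD clos]]].
  have mono (s s' : nat -> bool) x : (forall x, s x -> s' x) -> index_step s x -> index_step s' x.
    move=> sub; rewrite /index_step; case: ifP => // _; case: ifP => _.
      by move=> /andP[/sub-> /sub->].
    by move=> /andP[-> /sub].
  suff [s [cs hs]] : exists s : seq nat, index_of c \in s /\
      forall x, x \in s -> index_step (mem s) x.
    have [D hD] := ex_bits s; exists D; rewrite hD; split=> // x; rewrite hD => /hs.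
    by apply: mono => y; rewrite hD.
  have step i (s : seq nat) : (forall x, x \in s -> index_step (mem s) x) ->
      index_step (mem s) i -> exists s : seq nat, i \in s /\
      forall x, x \in s -> index_step (mem s) x.
    move=> hs he; exists (i :: s); split=> [|x]; first exact: mem_head.
    by rewrite inE => /orP[/eqP->|/hs]; [move: he|]; apply: mono => y; rewrite /= inE => ->; rewrite orbT.
  have two (s1 s2 : seq nat) : (forall x, x \in s1 -> index_step (mem s1) x) ->
      (forall x, x \in s2 -> index_step (mem s2) x) ->
      forall x, x \in s1 ++ s2 -> index_step (mem (s1 ++ s2)) x.
    move=> h1 h2 x; rewrite mem_cat => /orP[/h1|/h2]; apply: mono => y;
      by rewrite /= mem_cat => ->; rewrite ?orbT.
  elim: c => [|||||a [s [sa hs]] b [s' [sb hs']]|a [s [sa hs]] b [s' [sb hs']]|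
    a [s [sa hs]] b [s' [sb hs']]|a [s [sa hs]]] /=.
  1-5: by apply: (step _ [::]) => //; rewrite /index_step !npE.
  1-3: by apply: (step _ (s ++ s')); [exact: two|rewrite /index_step !npE /= !mem_cat sa sb orbT].
  by apply: (step _ s) => //; rewrite /index_step !npE /= sa.
elim/ltn_ind: e hD => e IH /clos; rewrite /index_step.
have lt_snd : 0 < nfst e -> nsnd e < e.
  by move=> p; rewrite -{2}[e]npair_eta; apply: leq_trans (leq_npair _ _); rewrite -addn1 addnC leq_add2r.
have le_fst x : nfst x <= x by rewrite -{2}[x]npair_eta; apply: leq_trans (leq_npair _ _); exact: leq_addr.
have le_snd x : nsnd x <= x by rewrite -{2}[x]npair_eta; apply: leq_trans (leq_npair _ _); exact: leq_addl.
rewrite -[in exists _, _ = _](npair_eta e).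
case: ifP => [lt5 /eqP->|ge5].
  case: (nfst e) lt5 => [|[|[|[|[|]]]]] // _.
  by exists CZero. by exists CSucc. by exists CFst. by exists CSnd. by exists COracle.
have e0 : 0 < nfst e by case: (nfst e) ge5.
case: ifP => [lt8 /andP[da db]|ge8 /andP[/eqP-> da]].
  have [a ea] := IH _ (leq_ltn_trans (le_fst _) (lt_snd e0)) da.
  have [b eb] := IH _ (leq_ltn_trans (le_snd _) (lt_snd e0)) db.
  rewrite -[nsnd e]npair_eta -ea -eb; case: (nfst e) ge5 lt8 => [|[|[|[|[|[|[|[|]]]]]]]] // _ _.
  by exists (CPair a b). by exists (CComp a b). by exists (CPrec a b).
by have [a <-] := IH _ (lt_snd e0) da; exists (CMu a).
Qed.

Definition eval_index (A : set nat) (e n m : nat) : Prop :=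
  exists2 c, index_of c = e & eval A c n m.

Lemma eval_indexE A c n m : eval_index A (index_of c) n m <-> eval A c n m.
Proof. by split=> [[d /index_of_inj->]|]; last by exists c. Qed.

Lemma arith_eval_index :
  arith (fun A z => eval_index A (nfst z) (nfst (nsnd z)) (nsnd (nsnd z))).
Proof.
pose V e := exists D, bit D e /\ forall x, bit D x -> index_step (bit D) x.
pose W A e n m := exists D, bit D (npair e (npair n m)) /\
  forall t, bit D t -> justified A (fun e n m => bit D (npair e (npair n m)))
                     (nfst t) (nfst (nsnd t)) (nsnd (nsnd t)).
apply: (@arith_ext (fun A z => V (nfst z) /\ W A (nfst z) (nfst (nsnd z)) (nsnd (nsnd z)))); last first.
  move=> A z; split=> [[/indexP[c <-] h]|[c <- /evalP h]].
    by apply/eval_indexE/evalP.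
  by split=> //; apply/indexP; exists c.
by apply: arith_and; [rewrite /V /index_step|rewrite /W /justified]; ar.
Qed.

Lemma arith_eval (Q : set nat -> nat -> set nat) e n m :
  arith (fun A z => Q A (nfst z) (nsnd z)) -> computable e -> computable n -> computable m ->
  arith (fun A z => eval_index (Q A z) (e z) (n z) (m z)).
Proof.
move=> hQ he hn hm.
have h : computable (fun z => npair (e z) (npair (n z) (m z))) by ucc.
by apply: arith_ext (arith_in arith_eval_index hQ h) _ => A z; rewrite !npE.
Qed.

Lemma arith_jump : arith jump.
Proof.
apply: (@arith_ext (fun A e => exists m, eval_index A e e m)).
  by apply: arith_ex; apply: (arith_eval (Q := fun A _ => A)); [apply: arith_mem|..]; ucc.
by move=> A e; split=> [[m [c <- h]]|[c [m [<- h]]]]; [exists c, m|exists m, c].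
Qed.

(** * Effective models *)

(** An effective model with the index that completes it to a tuple as in [rfn_out]. *)
Record emodel := EModel {
  em_set :> nat -> set nat;
  em_f : nat -> nat;
  em_g : nat -> nat -> nat;
  em_e : nat;
  em_P : effective_ACA0_model em_set em_f em_g }.

Definition em_code (m : emodel) : set nat := tuple4 m (em_f m) (em_g m) (em_e m).

Lemma em_jump (m : emodel) k i : m (iter k (em_f m) i) = iter k jump (m i).
Proof. by elim: k => [//|k IH] /=; case: (em_P m) => _ -> _; rewrite IH. Qed.

Lemma em_join (m : emodel) i j : m (em_g m i j) = join (m i) (m j).
Proof. by case: (em_P m). Qed.

Lemma em_down (m : emodel) i Y : turing_le Y (m i) -> exists j, m j = Y.
Proof. by case: (em_P m) => h _ _; apply: h. Qed.

Lemma tuple4_M M f g e i n : tuple4 M f g e (npair i n).*2 = M i n.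
Proof. by rewrite /tuple4 join_even /seq_set /= !npE. Qed.

Lemma tuple4_f M f g e z : tuple4 M f g e z.*2.*2.+1 = graph f z.
Proof. by rewrite /tuple4 join_odd join_even. Qed.

Lemma tuple4_g M f g e z : tuple4 M f g e z.*2.*2.+1.*2.+1 = graph2 g z.
Proof. by rewrite /tuple4 !join_odd join_even. Qed.

Lemma tuple4_e M f g e b : tuple4 M f g e b.*2.+1.*2.+1.*2.+1 = (b = e).
Proof. by rewrite /tuple4 !join_odd. Qed.

Lemma ucomp_graph I (O : I -> set nat) (f : I -> nat -> nat) :
  ucomp O (fun i => chi (graph (f i))) -> ucomp O f.
Proof.
move=> h; apply: (@ucomp_mu _ _ (fun i n k => 1 - chi (graph (f i)) (npair n k))).
- by apply: ucomp_sub (@ucomp_const _ _ 1) _; apply: (ucomp_app h); uc.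
- by move=> i n; rewrite chi1 // /graph /= !npE.
- move=> i n j lt_j; rewrite chi0 // /graph /= !npE => e.
  by rewrite e ltnn in lt_j.
Qed.

Section EffectiveModel.
Variables (I : Type) (O : I -> set nat) (m : I -> emodel).
Hypothesis m_comp : ucomp O (fun i => chi (em_code (m i))).

Lemma ucomp_em_set : ucomp O (fun i z => chi (m i (nfst z)) (nsnd z)).
Proof.
apply: (@ucomp_ext _ _ (fun i z => chi (em_code (m i)) z.*2)); last first.
  by apply: (ucomp_app m_comp); uc.
by move=> i z; rewrite /chi -{1}[z]npair_eta /em_code tuple4_M.
Qed.

Lemma ucomp_em_f : ucomp O (fun i => em_f (m i)).
Proof.
apply: ucomp_graph; apply: (@ucomp_ext _ _ (fun i z => chi (em_code (m i)) z.*2.*2.+1)).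
  by move=> i z; rewrite /chi /em_code tuple4_f.
by apply: (ucomp_app m_comp); uc.
Qed.

Lemma ucomp_em_g : ucomp O (fun i z => em_g (m i) (nfst z) (nsnd z)).
Proof.
apply: ucomp_graph.
apply: (@ucomp_ext _ _ (fun i z => chi (em_code (m i)) z.*2.*2.+1.*2.+1)).
  by move=> i z; rewrite /chi /em_code tuple4_g.
by apply: (ucomp_app m_comp); uc.
Qed.

Lemma ucomp_em_e : ucomp O (fun i _ => em_e (m i)).
Proof.
apply: (@ucomp_mu _ _ (fun i _ k => 1 - chi (em_code (m i)) k.*2.+1.*2.+1.*2.+1)).
- by apply: ucomp_sub (@ucomp_const _ _ 1) _; apply: (ucomp_app m_comp); uc.
- by move=> i n; rewrite chi1 // /em_code tuple4_e.
- by move=> i n j lt_j; rewrite chi0 // /em_code tuple4_e => e; rewrite e ltnn in lt_j.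
Qed.

(** By [arith_dec] it suffices to know finitely many jumps of each member, and these
    are again members, at indices computed by iterating [em_f]. *)
Lemma ucomp_em_arith R : arith R ->
  ucomp O (fun i z => `[< R (m i (nfst z)) (nsnd z) >]).
Proof.
move=> /arith_dec[k hk].
apply: (ucomp_subst (s := fun i j => m i j) hk).
apply: (@ucomp_ext _ _ (fun i z => chi (m i (iter k (em_f (m i)) (nfst z))) (nsnd z))).
  by move=> i z; rewrite em_jump.
have hf : ucomp O (fun i z => iter k (em_f (m i)) (nfst z)).
  apply: (@ucomp_iter _ _ (fun i _ => em_f (m i))); [|by uc|by uc].
  by apply: (ucomp_app ucomp_em_f); uc.
by apply: (ucomp_app2 (H := fun i j n => chi (m i j) n) ucomp_em_set hf); uc.
Qed.

End EffectiveModel.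

Lemma em_comprehension (m : emodel) i R : arith R -> exists j, m j = [set n | R (m i) n].
Proof.
move=> /arith_dec[k [c hc]]; apply: (@em_down m (iter k (em_f m) i)).
by exists c; apply/computesP => n; rewrite em_jump.
Qed.

Lemma em_le_code (m : emodel) j : turing_le (m j) (em_code m).
Proof.
have [|c hc] := proj1 (@ucomp_computes unit (fun _ => em_code m) (fun _ => m j)).
  apply: (@ucomp_ext _ _ (fun _ n => chi (em_code m) (npair j n).*2)); last by uc.
  by move=> _ n; rewrite /chi /em_code tuple4_M.
by exists c; exact: hc tt.
Qed.

(** ** Arithmetical problems and incompleteness *)

Definition arith_problem (P : problem) : Prop :=
  (exists2 R, arith R & forall X, dom P X <-> R X 0) /\
  (exists2 R, arith R & forall X Y, out P X Y <-> R (join X Y) 0).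

Definition total_problem (P : problem) : Prop :=
  forall X, dom P X -> exists Y, out P X Y.

(** A semantic form of the second incompleteness theorem.  A reduction would turn
    each solution [Y] of a fixed computable instance [X0] into an effective model
    [N_Y] containing further solutions of [X0].  Call those the successors of [Y].
    This relation is transitive, since the code of [N_Z] is computable from [Z],
    so that all members of [N_Z] are members of [N_Y] when [Z] is one.  As [N_Y] also contains the
    jumps of its members, there is a program, of index [E], that halts with oracle
    [Y] on [E] exactly if some successor of [Y] has a jump without [E].  Thus [E] is
    in the jump of [Y] iff it is not in the jump of some successor of [Y], and this
    is Yablo's paradox.  If [E] were not in the jump of [Y], it would be in the jumps
    of all successors [Z] of [Y]; but then it would be missing from the jump of a
    successor of [Z], which is a successor of [Y] too.  So [E] is in the jump of
    every solution, and therefore in that of none. *)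
Theorem rfn_not_le Q : arith_problem Q -> total_problem Q -> ~ weihrauch_le (rfn Q) Q.
Proof.
move=> [_ [Ro aRo RoE]] Qtot [c [d H]].
have [X0 [cX0 dX0 HX0]] := H set0 I.
have chiX0 : computable (chi X0).
  have hX : ucomp (fun _ : unit => set0) (fun _ => chi X0).
    by exists c => _ n; exact: (proj1 (computesP _ _ _) cX0).
  have /(ucomp_subst (s := fun _ _ => tt) hX) h :
      ucomp (fun A : set nat => A) (fun _ z => chi set0 (nsnd z)).
    by apply: (@ucomp_ext _ _ (fun _ _ => 0)); [move=> A z; rewrite chi0|uc].
  have := ucomp_app h (ucomp_pair (@ucomp_const _ _ 0) (@ucomp_id _ _)).
  by apply: ucomp_ext => A n; rewrite npE.
have aX0 : arith (fun A _ => A = X0).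
  apply: (@arith_ext (fun A _ => forall k, A k <-> chi X0 k = 1)).
    by ar; apply: arith_eq; ucc.
  move=> A _; rewrite predeqE; split=> h k; rewrite h /chi; case: asboolP => //.
pose J := {Y | out Q X0 Y}.
have /choice[m hm] : forall i : J, exists m : emodel,
    computes d (join set0 (sval i)) (em_code m) /\
    forall k, dom Q (m k) -> exists j, out Q (m k) (m j).
  move=> [Y oY]; have [V [hV [M [f [g [e [eV hM _ refl]]]]]]] := HX0 Y oY.
  by exists (EModel e hM); split=> //; rewrite /em_code /= -eV.
have m_comp : ucomp (fun i : J => sval i) (fun i => chi (em_code (m i))).
  have h1 : ucomp (fun i : J => join set0 (sval i)) (fun i => chi (em_code (m i))).
    by exists d => i; apply/computesP; case: (hm i).
  have /(ucomp_subst (s := fun i _ => i) h1) H1 :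
      ucomp (fun i : J => sval i) (fun i z => chi (join set0 (sval i)) (nsnd z)).
    apply: (@ucomp_ext _ _ (fun i z => if odd (nsnd z) then chi (sval i) (nsnd z)./2 else 0)).
      by move=> i z; rewrite /chi /join /=; case: odd => //; rewrite asboolF.
    by uc.
  have := ucomp_app H1 (ucomp_pair (@ucomp_const _ _ 0) (@ucomp_id _ _)).
  by apply: ucomp_ext => A n; rewrite npE.
have X0_in (i : J) : exists x, m i x = X0.
  apply: (@em_down _ 0); have [e he] := chiX0.
  by exists e; apply/computesP => n; exact: he.
(* [CMu c1] searches, on input [e], for an index [x] of [X0] and a solution of [X0]
   whose jump omits [e]; [x] is searched for because it depends on the model. *)
pose B (i : J) e x j :=
  [&& `[< m i x = X0 >], `[< Ro (m i (em_g (m i) x j)) 0 >] & ~~ `[< jump (m i j) e >]].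
have [c1 hc1] : ucomp (fun i : J => sval i)
    (fun i z => ~~ B i (nfst z) (nfst (nsnd z)) (nsnd (nsnd z))).
  rewrite /B; uc.
  - have h := ucomp_em_arith m_comp aX0.
    apply: (@ucomp_ext _ _ _ _ _ (ucomp_app h (G := fun _ z => npair (nfst (nsnd z)) 0) _)); last by uc.
    by move=> i z; rewrite !npE.
  - have h := ucomp_em_arith m_comp aRo.
    apply: (@ucomp_ext _ _ _ _ _ (ucomp_app h (G := fun i z => npair (em_g (m i) (nfst (nsnd z)) (nsnd (nsnd z))) 0) _)).
      by move=> i z; rewrite !npE.
    by apply: ucomp_pair (@ucomp_const _ _ 0); apply: (ucomp_app (ucomp_em_g m_comp)); uc.
  - have h := ucomp_em_arith m_comp arith_jump.
    apply: (@ucomp_ext _ _ _ _ _ (ucomp_app h (G := fun _ z => npair (nsnd (nsnd z)) (nfst z)) _)); last by uc.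
    by move=> i z; rewrite !npE.
pose E := index_of (CMu c1).
have key (i : J) : jump (sval i) E <-> exists j, out Q X0 (m i j) /\ ~ jump (m i j) E.
  rewrite jump_index (halts_mu _ (hc1 i)); split=> [[z]|[j [oj nj]]].
    rewrite !npE /B; case: and3P => // -[/asboolP ex /asboolP]; rewrite em_join ex -RoE.
    by move=> oj /asboolP nj _; exists (nsnd z).
  have [x ex] := X0_in i; exists (npair x j); rewrite !npE /B ex em_join ex.
  by rewrite (asboolT (erefl X0)) (asboolT (proj1 (RoE _ _) oj)) (asboolF nj).
have all_jump (i : J) : jump (sval i) E.
  have solution : exists j, out Q X0 (m i j).
    have [x ex] := X0_in i; rewrite -ex; have [_] := hm i; apply; by rewrite ex.
  have [j oj] := solution; apply: contrapT => ni; apply: (ni); apply/key.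
  have [jE|] := pselect (jump (m i j) E); last by exists j.
  have /key[j' [oj' nj']] : jump (sval (exist _ _ oj : J)) E by [].
  have [|k ek] := @em_down (m i) j (m (exist _ _ oj) j').
    apply: turing_le_trans (em_le_code _ _) _.
    have [|b hb] := proj1 (@ucomp_computes J (fun i => sval i) (fun i => em_code (m i))) => //.
    by exists b; exact: (hb (exist _ _ oj)).
  by exists k; rewrite ek.
have [Y oY] := Qtot _ dX0.
have /key[j [oj]] := all_jump (exist _ _ oY).
by apply; exact: (all_jump (exist _ _ oj)).
Qed.

(** ** Reflection preserves arithmetical problems *)

Definition functional (F : nat -> Prop) : Prop :=
  forall i, exists a, forall b, F (npair i b) <-> b = a.

Lemma functionalP F : functional F <-> exists f, F = graph f.
Proof.
split=> [/choice[f hf]|[f ->] i]; last first.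
  by exists (f i) => b; rewrite /graph /= !npE; split.
by exists f; rewrite predeqE => z; rewrite -{1}[z]npair_eta hf /graph /=; split.
Qed.

(** The components of a code [tuple4 M f g e], read off at the places where the
    nested joins put them. *)
Definition slot_M (Y : set nat) (i : nat) : set nat := [set n | Y (npair i n).*2].
Definition slot_f (Y : set nat) : set nat := [set z | Y z.*2.*2.+1].
Definition slot_g (Y : set nat) : set nat := [set z | Y z.*2.*2.+1.*2.+1].
Definition slot_e (Y : set nat) : set nat := [set b | Y b.*2.+1.*2.+1.*2.+1].

Lemma join_eta A : join [set n | A n.*2] [set n | A n.*2.+1] = A.
Proof.
rewrite predeqE => n; rewrite /join /=; have := odd_double_half n.
by case: (odd n); rewrite ?add1n ?add0n => ->.
Qed.

Lemma slots Y : Y = join (seq_set (slot_M Y)) (join (slot_f Y) (join (slot_g Y) (slot_e Y))).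
Proof.
rewrite -[LHS]join_eta; congr (join _ _).
  by rewrite predeqE => z; rewrite /seq_set /slot_M /= npE.
rewrite -[LHS]join_eta; congr (join _ _).
by rewrite -[LHS]join_eta; congr (join _ _).
Qed.

(** All quantifiers over sets and functions disappear: the functions are replaced by
    their graphs, and closure under Turing reducibility is quantified over the
    indices of the reductions. *)
Lemma rfn_outE P X Y : rfn_out P X Y <->
  [/\ functional (slot_f Y), functional (slot_g Y) & exists e, forall b, slot_e Y b <-> b = e] /\
  [/\ forall i e,
        (forall n, eval_index (slot_M Y i) e n 0 \/ eval_index (slot_M Y i) e n 1) ->
        exists j, slot_M Y j = [set n | eval_index (slot_M Y i) e n 1],
      forall i a, slot_f Y (npair i a) -> slot_M Y a = jump (slot_M Y i) &
      forall i j a, slot_g Y (npair (npair i j) a) ->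
        slot_M Y a = join (slot_M Y i) (slot_M Y j)] /\
  (forall e, slot_e Y e -> slot_M Y e = X) /\
  forall i, dom P (slot_M Y i) -> exists j, out P (slot_M Y i) (slot_M Y j).
Proof.
split=> [[M [f [g [e [-> [down hj hg] eX refl]]]]]|].
  have EM : slot_M (tuple4 M f g e) = M.
    by apply/funext => i; rewrite predeqE => n; rewrite /slot_M /= tuple4_M.
  have Ef : slot_f (tuple4 M f g e) = graph f.
    by rewrite predeqE => n; rewrite /slot_f /= tuple4_f.
  have Eg : slot_g (tuple4 M f g e) = graph2 g.
    by rewrite predeqE => n; rewrite /slot_g /= tuple4_g.
  have Ee : slot_e (tuple4 M f g e) = [set e].
    by rewrite predeqE => n; rewrite /slot_e /= tuple4_e.
  rewrite EM Ef Eg Ee; split; [split|split; [split|split]].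
  - by apply/functionalP; exists f.
  - by apply/functionalP; eexists; reflexivity.
  - by exists e.
  - move=> i k tot; apply: (down i).
    have [c ck _] : exists2 c, index_of c = k & True.
      by case: (tot 0) => -[c ck _]; exists c.
    exists c => n; rewrite -ck /=; split=> [/eval_indexE//|n1].
    by case: (tot n); rewrite -ck // => /eval_indexE.
  - by move=> i a; rewrite /graph /= !npE => <-; exact: hj.
  - by move=> i j a; rewrite /graph2 /graph /= !npE => <-; exact: hg.
  - by move=> _ ->.
  - exact: refl.
move=> [[/functionalP[f hf] /functionalP[g hg] [e he]] [[down hj hjoin] [eX refl]]].
exists (slot_M Y), f, (fun i j => g (npair i j)), e; split=> //.
- rewrite {1}(slots Y) hf hg /tuple4 /graph2; congr (join _ (join _ (join _ _))).
    by rewrite predeqE => z; rewrite /graph /= npE.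
  by rewrite predeqE => z; exact: he.
- split.
  + move=> i Z [c hc]; have [|j ej] := down i (index_of c).
      by move=> n; have [/(proj1 (hc n))|/(proj2 (hc n))] := pselect (Z n); [right|left]; apply/eval_indexE.
    exists j; rewrite ej (computes_set hc) predeqE => n /=; exact: eval_indexE.
  + by move=> i; apply: hj; rewrite hf /graph /= !npE.
  + by move=> i j; apply: hjoin; rewrite hg /graph /= !npE.
- by apply: eX; apply/he.
Qed.

Lemma arith_functional F : arith (fun A z => F A z) -> arith (fun A _ => functional (F A)).
Proof.
move=> hF; rewrite /functional; apply: arith_all; apply: arith_ex; apply: arith_all.
by apply: arith_iff; [apply: (arith_reindex hF); ucc|ar].
Qed.

Lemma arith_jump_in (Q : set nat -> nat -> set nat) h :
  arith (fun A z => Q A (nfst z) (nsnd z)) -> computable h ->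
  arith (fun A n => jump (Q A n) (h n)).
Proof. by move=> hQ hh; exact: (arith_in arith_jump hQ hh). Qed.

Lemma arith_rfn P : arith_problem P -> arith_problem (rfn P).
Proof.
move=> [[Rd aRd RdE] [Ro aRo RoE]]; split.
  by exists (fun _ _ => True); [exact: arith_true|].
pose Y (A : set nat) : set nat := [set n | A n.*2.+1].
pose X (A : set nat) : set nat := [set n | A n.*2].
exists (fun A _ =>
  [/\ functional (slot_f (Y A)), functional (slot_g (Y A)) &
      exists e, forall b, slot_e (Y A) b <-> b = e] /\
  [/\ forall i e,
        (forall n, eval_index (slot_M (Y A) i) e n 0 \/ eval_index (slot_M (Y A) i) e n 1) ->
        exists j, slot_M (Y A) j = [set n | eval_index (slot_M (Y A) i) e n 1],
      forall i a, slot_f (Y A) (npair i a) -> slot_M (Y A) a = jump (slot_M (Y A) i) &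
      forall i j a, slot_g (Y A) (npair (npair i j) a) ->
        slot_M (Y A) a = join (slot_M (Y A) i) (slot_M (Y A) j)] /\
  (forall e, slot_e (Y A) e -> slot_M (Y A) e = X A) /\
  forall i, Rd (slot_M (Y A) i) 0 -> exists j, Ro (join (slot_M (Y A) i) (slot_M (Y A) j)) 0).
  rewrite /slot_f /slot_g /slot_e /slot_M /X /Y /join.
  apply: arith_and; [apply: arith_and3|apply: arith_and; [apply: arith_and3|apply: arith_and]].
  - by apply: arith_functional; ar.
  - by apply: arith_functional; ar.
  - by ar.
  - apply: arith_all; apply: arith_all; apply: arith_imp.
      by apply: arith_all; apply: arith_or; apply: arith_eval; ar; ucc.
    apply: arith_ex; apply: arith_seteq; first by ar.
    by cbv beta delta [mkset]; apply: arith_eval; ar; ucc.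
  - apply: arith_all; apply: arith_all; apply: arith_imp; first by ar.
    apply: arith_seteq; first by ar.
    by apply: arith_jump_in; ar; ucc.
  - by ar.
  - by ar.
  - apply: arith_all; apply: arith_imp; first by apply: (arith_in aRd); ar; ucc.
    by apply: arith_ex; apply: (arith_in aRo); ar; ucc.
move=> X0 Y0; have -> : Y (join X0 Y0) = Y0.
  by rewrite predeqE => n; rewrite /Y /= join_odd.
have -> : X (join X0 Y0) = X0.
  by rewrite predeqE => n; rewrite /X /= join_even.
rewrite /= rfn_outE; split=> -[h1 [h2 [h3 h4]]]; do ![split=> //] => i.
  by move=> /RdE /h4[j oj]; exists j; apply/RoE.
by move=> /RdE /h4[j oj]; exists j; apply/RoE.
Qed.

(** ** Arithmetical transfinite recursion *)

Lemma arith_linear_order : arith (fun A _ => linear_order A).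
Proof.
by rewrite /linear_order /field /ord_le; apply: arith_and4; ar.
Qed.

Lemma arith_ATR2 : arith_problem ATR2.
Proof.
split.
  exists (fun A _ => linear_order [set n | A n.*2]).
    apply: (arith_in (Q := fun A _ => [set n | A n.*2]) (h := fun=> 0) arith_linear_order); first by ar.
    by ucc.
  move=> X; split=> [[L [A [-> lin]]]|lin].
    suff -> : [set n | join L A n.*2] = L by [].
    by rewrite predeqE => n; rewrite /= join_even.
  by exists [set n | X n.*2], [set n | X n.*2.+1]; rewrite join_eta.
pose L (A : set nat) := [set n | A n.*2.*2].
pose B (A : set nat) := [set n | A n.*2.+1.*2].
pose H (A : set nat) := [set n | A n.*2.+1].
exists (fun A _ => jump_hierarchy (L A) (B A) (H A) \/
  (functional (H A) /\
   forall n a b, H A (npair n a) -> H A (npair n.+1 b) -> ord_lt (L A) b a)).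
  rewrite /jump_hierarchy /ord_lt /is_min /field /ord_le /column /below /L /B /H.
  apply: arith_or; [apply: arith_and|apply: arith_and].
  - by ar.
  - apply: arith_all; apply: arith_imp; first by ar.
    apply: arith_and; first by ar.
    apply: arith_imp; first by ar.
    apply: arith_seteq; first by ar.
    by apply: arith_jump_in; rewrite /ord_lt /ord_le; ar; ucc.
  - by apply: arith_functional; ar.
  - by ar.
move=> X Y.
have eH : H (join X Y) = Y by rewrite predeqE => n; rewrite /H /= join_odd.
have eL : L (join X Y) = [set n | X n.*2] by rewrite predeqE => n; rewrite /L /= join_even.
have eB : B (join X Y) = [set n | X n.*2.+1] by rewrite predeqE => n; rewrite /B /= join_even.
rewrite eH eL eB.
have seqE L0 : (exists f, Y = graph f /\ descending L0 f) <-> (functional Y /\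
   forall n a b, Y (npair n a) -> Y (npair n.+1 b) -> ord_lt L0 b a).
  split=> [[f [-> desc]]|[/functionalP[f ->] desc]].
    split; first by apply/functionalP; exists f.
    by move=> n a b; rewrite /graph /= !npE => <- <-; exact: desc.
  by exists f; split=> // n; apply: (desc n); rewrite /graph /= !npE.
split=> [[L0 [A0 [eX h]]]|h].
  have [<- <-] : L0 = [set n | X n.*2] /\ A0 = [set n | X n.*2.+1].
    by apply: join_inj; rewrite join_eta.
  by case: h => [|/seqE]; [left|right].
exists [set n | X n.*2], [set n | X n.*2.+1]; rewrite join_eta; split=> //.
by case: h => [|/seqE]; [left|right].
Qed.

(** ** Existence of solutions *)

Lemma wf_or_descending (R : nat -> nat -> Prop) :
  well_founded R \/ exists f : nat -> nat, forall n, R (f n.+1) (f n).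
Proof.
have [|nwf] := pselect (well_founded R); [by left|right].
have [x0 nx0] : exists x, ~ Acc R x by apply/existsNP.
have [|g hg] := @choice _ _ (fun x y => ~ Acc R x -> R y x /\ ~ Acc R y).
  move=> x; have [ax|nax] := pselect (Acc R x); first by exists 0.
  apply: contrapT => h; apply: (nax); constructor => y Ryx.
  by apply: contrapT => nay; apply: h; exists y.
exists (fun n => iter n g x0) => n; suff : ~ Acc R (iter n g x0) by case/hg.
by elim: n => [//|n /hg[]].
Qed.

Lemma ex_jump_hierarchy L A : well_founded (ord_lt L) -> exists H, jump_hierarchy L A H.
Proof.
move=> wf.
pose F i (rec : forall j, ord_lt L j i -> set nat) : set nat :=
  if `[< is_min L i >] then A
  else jump [set z | exists h : ord_lt L (nfst z) i, rec _ h (nsnd z)].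
pose H := Fix wf (fun _ => set nat) F.
have HE i : H i = if `[< is_min L i >] then A
    else jump [set z | ord_lt L (nfst z) i /\ H (nfst z) (nsnd z)].
  rewrite /H Fix_eq => [|j f g fg]; last first.
    by congr F; apply/functional_extensionality_dep => k; apply/funext => h.
  rewrite {1}/F; case: ifP => // _; congr jump; rewrite predeqE => z /=.
  by split=> [[h Hz]|[h Hz]]; [split|exists h].
exists [set z | field L (nfst z) /\ H (nfst z) (nsnd z)]; split=> [z []//|i Li].
have -> : column [set z | field L (nfst z) /\ H (nfst z) (nsnd z)] i = H i.
  by rewrite predeqE => n; rewrite /column /= !npE; split=> [[]|].
rewrite HE; split=> [mi|nmi]; first by rewrite asboolT.
rewrite asboolF //; congr jump; rewrite predeqE => z; rewrite /below /=.
by split=> [[lt Hz]|[[_ Hz] lt]]; do !split=> //; exists i; left; case: lt.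
Qed.

Lemma ATR2_total : total_problem ATR2.
Proof.
move=> _ [L [A [-> _]]]; have [/ex_jump_hierarchy|[f df]] := wf_or_descending (ord_lt L).
  by move=> /(_ A)[H hH]; exists H, L, A; split; [|left].
by exists (graph f), L, A; split=> //; right; exists f.
Qed.

(** Names for the members of the smallest effective model containing [X] and
    closed under a given choice of solutions. *)
Inductive name :=
| NBase | NJump of name | NJoin of name & name | NRed of code & name | NSol of name.

Fixpoint name_index (t : name) : nat :=
  match t with
  | NBase => npair 0 0
  | NJump t => npair 1 (name_index t)
  | NJoin t u => npair 2 (npair (name_index t) (name_index u))
  | NRed c t => npair 3 (npair (index_of c) (name_index t))
  | NSol t => npair 4 (name_index t)
  end.

Lemma name_index_inj : injective name_index.
Proof.
elim=> [|t IH|t IHt u IHu|c t IH|t IH] [|t'|t' u'|c' t'|t'] //= /npair_inj[] //.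
- by move=> _ /IH->.
- by move=> _ /npair_inj[/IHt-> /IHu->].
- by move=> _ /npair_inj[/index_of_inj-> /IH->].
- by move=> _ /IH->.
Qed.

(** Since the problem has only one chosen solution for each instance, the closure of
    [X] under jumps, joins, reductions and solutions is countable. *)
Lemma rfn_total P : total_problem P -> total_problem (rfn P).
Proof.
move=> tot X _.
have [|sol hsol] := @choice _ _ (fun X Y => dom P X -> out P X Y).
  by move=> Z; have [/tot[Y]|] := pselect (dom P Z); [exists Y|exists set0].
pose den := fix den t := match t with
  | NBase => X
  | NJump t => jump (den t)
  | NJoin t u => join (den t) (den u)
  | NRed c t => [set n | eval (den t) c n 1]
  | NSol t => sol (den t)
  end.
have [|name_of name_ofP] := @choice _ _ (fun n t => (exists t, name_index t = n) -> name_index t = n).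
  by move=> n; have [[t]|] := pselect (exists t, name_index t = n); [exists t|exists NBase].
have nameK t : name_of (name_index t) = t.
  by apply: name_index_inj; apply: name_ofP; exists t.
pose M n := den (name_of n).
have ME t : M (name_index t) = den t by rewrite /M nameK.
exists (tuple4 M (fun i => name_index (NJump (name_of i)))
  (fun i j => name_index (NJoin (name_of i) (name_of j))) (name_index NBase)).
do 4!eexists; split; first reflexivity.
- split=> [i Y [c hc]|i|i j]; rewrite ?ME //.
  by exists (name_index (NRed c (name_of i))); rewrite ME (computes_set hc).
- by rewrite ME.
- by move=> i di; exists (name_index (NSol (name_of i))); rewrite ME; exact: hsol.
Qed.

(** * Arithmetical problems reduce to finding paths *)

Lemma code_cons a s : CodeSeq.code (a :: s) = 2 ^ a * (CodeSeq.code s).*2.+1.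
Proof. by []. Qed.

(** The number [2 ^ a * (2 * x + 1)] codes the sequence with head [a] and a tail
    coded by [x]; these functions decode it arithmetically. *)
Definition seq_head (x : nat) : nat := head 0 (CodeSeq.decode x).
Definition seq_tail (x : nat) : nat := CodeSeq.code (behead (CodeSeq.decode x)).
Definition seq_size (x : nat) : nat := size (CodeSeq.decode x).
Definition seq_nth (x i : nat) : nat := nth 0 (CodeSeq.decode x) i.

Lemma iter_half_pow a y n : n <= a -> iter n half (2 ^ a * y) = 2 ^ (a - n) * y.
Proof.
elim: n a => [|n IH] [|a] // le_na; rewrite ?subn0 // iterSr subSS -IH //.
by rewrite expnS -mulnA mul2n doubleK.
Qed.

Lemma computable_head : computable seq_head.
Proof.
apply: (@ucomp_mu _ _ (fun _ x n => ~~ ((x == 0) || odd (iter n half x)))).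
- uc; apply: (@ucomp_iter _ _ (fun _ _ => half)); uc.
- move=> _ x; rewrite /seq_head -{1 3}[x]CodeSeq.decodeK.
  case: (CodeSeq.decode x) => [//|a s]; rewrite code_cons [head _ _]/= iter_half_pow // subnn mul1n.
  by rewrite /= odd_double orbT.
- move=> _ x n; rewrite /seq_head -{2 3}[x]CodeSeq.decodeK.
  case: (CodeSeq.decode x) => [//|a s] lt_na; rewrite code_cons iter_half_pow ?(ltnW lt_na) //.
  by rewrite muln_eq0 expn_eq0 /= oddM oddX subn_eq0 leqNgt lt_na.
Qed.

Lemma computable_tail : computable seq_tail.
Proof.
apply: (@ucomp_ext _ _ (fun _ x => (iter (seq_head x) half x)./2)).
  move=> _ x; rewrite /seq_head /seq_tail -{2}[x]CodeSeq.decodeK.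
  case: (CodeSeq.decode x) => [//|a s]; rewrite code_cons iter_half_pow // subnn mul1n.
  by rewrite /= uphalf_double.
have h := computable_head.
by apply: ucomp_half; apply: (@ucomp_iter _ _ (fun _ _ => half)); uc.
Qed.

Lemma iter_tail x i : iter i seq_tail x = CodeSeq.code (drop i (CodeSeq.decode x)).
Proof.
elim: i => [|i IH] /=; first by rewrite drop0 CodeSeq.decodeK.
by rewrite IH /seq_tail CodeSeq.codeK -drop1 drop_drop.
Qed.

Lemma computable_iter_tail F G : computable F -> computable G ->
  computable (fun z => iter (F z) seq_tail (G z)).
Proof.
move=> hF hG; have h := computable_tail.
by apply: (@ucomp_iter _ _ (fun _ _ => seq_tail)) => //; uc.
Qed.

Lemma computable_nth : computable (fun z => seq_nth (nfst z) (nsnd z)).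
Proof.
apply: (@ucomp_ext _ _ (fun _ z => seq_head (iter (nsnd z) seq_tail (nfst z)))).
  move=> _ z; rewrite iter_tail /seq_head CodeSeq.codeK /seq_nth.
  by rewrite -nth0 nth_drop addn0.
by apply: ucomp_computable computable_head _; apply: computable_iter_tail; ucc.
Qed.

Lemma computable_size : computable seq_size.
Proof.
have code0 s : (CodeSeq.code s == 0) = (s == [::]).
  by rewrite -(can_eq CodeSeq.codeK s).
apply: (@ucomp_mu _ _ (fun _ x n => iter n seq_tail x)).
- by apply: computable_iter_tail; ucc.
- by move=> _ x; rewrite iter_tail drop_size.
- move=> _ x n lt_n; apply/eqP; rewrite iter_tail code0 -size_eq0 size_drop.
  by rewrite subn_eq0 -ltnNge.
Qed.

(** A condition on a set [A] and a function [w] is closed, uniformly computably, if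
    it is a conjunction of conditions numbered by [z], each of which tests one
    membership in [A] and three values of [w]: three is what a node of a truth
    table with its two children needs. *)
Definition closed_condition (K : set nat -> (nat -> nat) -> Prop) : Prop :=
  exists (p q r s : nat -> nat) (rho : nat -> bool),
    [/\ computable p, computable q, computable r, computable s &
        computable (fun x => rho x)] /\
    forall A w, K A w <-> forall z,
      rho (npair z (npair (chi A (p z)) (npair (w (q z)) (npair (w (r z)) (w (s z)))))).

Lemma closed_and K1 K2 : closed_condition K1 -> closed_condition K2 ->
  closed_condition (fun A w => K1 A w /\ K2 A w).
Proof.
move=> [p [q [r [s [rho [[hp hq hr hs hrho] h]]]]]].
move=> [p' [q' [r' [s' [rho' [[hp' hq' hr' hs' hrho'] h']]]]]].
pose br (f f' : nat -> nat) z := if nfst z == 0 then f (nsnd z) else f' (nsnd z).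
exists (br p p'), (br q q'), (br r r'), (br s s').
exists (fun x => if nfst (nfst x) == 0 then rho (npair (nsnd (nfst x)) (nsnd x))
                 else rho' (npair (nsnd (nfst x)) (nsnd x))); split.
  rewrite /br /computable; split; uc.
    by apply: ucomp_computable hrho _; uc.
  by apply: ucomp_computable hrho' _; uc.
move=> A w; rewrite h h' /br; split=> [[k k'] z|k].
  by rewrite !npE; case: (nfst z == 0); [exact: k|exact: k'].
by split=> z; [move: (k (npair 0 z))|move: (k (npair 1 z))]; rewrite !npE.
Qed.

Lemma closed_comp K pi : closed_condition K -> computable pi ->
  closed_condition (fun A w => K A (w \o pi)).
Proof.
move=> [p [q [r [s [rho [[hp hq hr hs hrho] h]]]]]] hpi.
exists p, (pi \o q), (pi \o r), (pi \o s), rho; split.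
  by split=> //; apply: (ucomp_computable hpi).
by move=> A w; rewrite h.
Qed.

(** [K A w] forces [w] to contain a truth table for [R A] at the places [(0, n)],
    with value 0 for true.  The rest of [w] tabulates the constituents of [R]; at a
    false universal statement, [w] is the successor of a counterexample, so that
    the correctness of the table is a closed condition. *)
Definition tabulated (R : set nat -> nat -> Prop) : Prop :=
  exists K, [/\ closed_condition K,
    forall A w, K A w -> forall n, w (npair 0 n) = 0 <-> R A n &
    forall A, exists w, K A w].

(** The constituents of [R] are tabulated at the places [(1, x)] and [(2, x)]. *)
Lemma arith_tabulated R : arith R -> tabulated R.
Proof.
elim=> [h hh|h hh|P Q _ [K1 [c1 t1 e1]] _ [K2 [c2 t2 e2]]|P _ [K [c t e]]].
- exists (fun A w => forall z, (w (npair 0 z) == 0) == (chi A (h z) != 0)); split.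
  + exists h, (npair 0), id, id,
      (fun x => (nfst (nsnd (nsnd x)) == 0) == (nfst (nsnd x) != 0)).
    split; first by split=> //; ucc.
    by move=> A w; split=> H z; move: (H z); rewrite !npE.
  + move=> A w H n; have /eqP e := H n; rewrite chi_eq0 negbK in e.
    by split=> [/eqP|/asboolP h1]; [rewrite e => /asboolP|apply/eqP; rewrite e].
  + move=> A; exists (fun x => ~~ (chi A (h (nsnd x)) != 0)) => z; rewrite npE.
    by case: (chi A (h z)).
- exists (fun A w => forall z, (w (npair 0 z) == 0) == (h z == 0)); split.
  + exists id, (npair 0), id, id,
      (fun x => (nfst (nsnd (nsnd x)) == 0) == (h (nfst x) == 0)).
    split; first by split=> //; ucc.
    by move=> A w; split=> H z; move: (H z); rewrite !npE.
  + move=> A w H n; have /eqP e := H n.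
    by split=> /eqP h0; apply/eqP; [rewrite -e|rewrite e].
  + by move=> A; exists (fun x => h (nsnd x)) => z; rewrite npE.
- exists (fun A w => (K1 A (w \o npair 1) /\ K2 A (w \o npair 2)) /\
    forall z, (w (npair 0 z) == 0) ==
      ((w (npair 1 (npair 0 z)) == 0) ==> (w (npair 2 (npair 0 z)) == 0))); split.
  + apply: closed_and; first by apply: closed_and; apply: closed_comp => //; ucc.
    exists id, (npair 0), (fun z => npair 1 (npair 0 z)), (fun z => npair 2 (npair 0 z)),
      (fun x => (nfst (nsnd (nsnd x)) == 0) ==
        ((nfst (nsnd (nsnd (nsnd x))) == 0) ==> (nsnd (nsnd (nsnd (nsnd x))) == 0))).
    split; first by split=> //; ucc.
    by move=> A w; split=> H z; move: (H z); rewrite !npE.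
  + move=> A w [[/t1 h1 /t2 h2] H] n; have /eqP e := H n.
    rewrite -h1 -h2 /=; split=> [/eqP|i].
      by rewrite e => /implyP i /eqP/i/eqP.
    by apply/eqP; rewrite e; apply/implyP => /eqP/i/eqP.
  + move=> A; have [w1 k1] := e1 A; have [w2 k2] := e2 A.
    exists (fun x => if nfst x == 0 then
        ~~ ((w1 (npair 0 (nsnd x)) == 0) ==> (w2 (npair 0 (nsnd x)) == 0)) : nat
      else if nfst x == 1 then w1 (nsnd x) else w2 (nsnd x)).
    split; first split.
    * by rewrite (_ : _ \o _ = w1) //; apply/funext => x /=; rewrite !npE.
    * by rewrite (_ : _ \o _ = w2) //; apply/funext => x /=; rewrite !npE.
    * by move=> z; rewrite !npE /=; case: (_ ==> _).
- exists (fun A w => K A (w \o npair 1) /\ forall z,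
    ((w (npair 0 (nsnd z)) == 0) ==> (w (npair 1 (npair 0 z)) == 0)) &&
    ((w (npair 0 (nsnd z)) == (nfst z).+1) ==> (w (npair 1 (npair 0 z)) != 0))); split.
  + apply: closed_and; first by apply: closed_comp => //; ucc.
    exists id, (fun z => npair 0 (nsnd z)), (fun z => npair 1 (npair 0 z)), id,
      (fun x => ((nfst (nsnd (nsnd x)) == 0) ==> (nfst (nsnd (nsnd (nsnd x))) == 0)) &&
        ((nfst (nsnd (nsnd x)) == (nfst (nfst x)).+1) ==>
         (nfst (nsnd (nsnd (nsnd x))) != 0))).
    split; first by split=> //; ucc.
    by move=> A w; split=> H z; move: (H z); rewrite !npE.
  + move=> A w [/t h H] n; split=> [w0 k|all].
      by apply/h; have := H (npair k n); rewrite !npE w0 /= => /andP[/eqP].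
    case w0: (w (npair 0 n)) => [//|k]; have := H (npair k n).
    by rewrite !npE w0 eqxx /= => /eqP[]; apply/h.
  + move=> A; have [w k] := e A.
    have [|cex hcex] := @choice _ _ (fun n k => (exists k, w (npair 0 (npair k n)) <> 0) ->
                                     w (npair 0 (npair k n)) <> 0).
      move=> n; have [[j hj]|] := pselect (exists k, w (npair 0 (npair k n)) <> 0).
        by exists j.
      by exists 0.
    exists (fun x => if nfst x == 0 then
        if `[< exists k, w (npair 0 (npair k (nsnd x))) <> 0 >] then (cex (nsnd x)).+1 else 0
      else w (nsnd x)).
    split; first by rewrite (_ : _ \o _ = w) //; apply/funext => x /=; rewrite !npE.
    move=> z; rewrite !npE /=; case: asboolP => [ex|nex] /=.
      by apply/implyP => /eqP[e0]; rewrite -[z]npair_eta -e0; apply/eqP; exact: hcex.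
    by rewrite andbT; apply/eqP; apply: contrapT => h; apply: nex; exists (nfst z); rewrite npair_eta.
Qed.

(** A closed condition on a pair consisting of a set [Y] and a function [w] is the
    set of paths of a tree: a finite sequence is discarded once it is long enough
    to violate one of the conditions numbered below its length. *)
Theorem arith_problem_le_CBaire P :
  arith_problem P -> total_problem P -> weihrauch_le P CBaire.
Proof.
move=> [_ [R aR RE]] tot.
have [K [[p [q [r [s [rho [[hp hq hr hs hrho] KE]]]]]] tab exK]] := arith_tabulated aR.
(* The path lists the solution at the places (0, n), with value 0 for membership,
   and the truth table at the places (1, x). *)
pose node X (t : nat -> nat) z := rho (npair z (npair
  (if odd (p z) then (t (npair 0 (p z)./2) == 0 : nat) else chi X (p z)./2)
  (npair (t (npair 1 (q z))) (npair (t (npair 1 (r z))) (t (npair 1 (s z))))))).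
pose seen l z := [&& npair 0 (p z)./2 < l, npair 1 (q z) < l, npair 1 (r z) < l &
                     npair 1 (s z) < l].
pose root := npair 1 (npair 0 0).
pose T X : set nat := [set x |
  all (fun z => seen (seq_size x) z ==> node X (seq_nth x) z) (iota 0 (seq_size x)) &&
  ((root < seq_size x) ==> (seq_nth x root == 0))].
have [c hc] : exists c, forall X, computes c X (T X).
  apply: (proj1 (@ucomp_computes (set nat) id T)).
  pose b X x : bool :=
    all (fun z => seen (seq_size x) z ==> node X (seq_nth x) z) (iota 0 (seq_size x)) &&
    ((root < seq_size x) ==> (seq_nth x root == 0)).
  apply: (@ucomp_ext _ _ (fun X x => b X x)).
    by move=> X x; rewrite /chi; congr (nat_of_bool _); apply/idP/asboolP.
  have hsz := computable_size.
  have hnth F G : ucomp id F -> ucomp id G -> ucomp id (fun X n => seq_nth (F X n) (G X n)).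
    move=> hF hG; apply: (ucomp_app2 (H := fun _ => seq_nth) _ hF hG).
    exact: (computableP _ computable_nth).
  rewrite /b /seen /node; uc; try (apply: ucomp_computable hrho _; uc); apply: hnth; uc.
have pathE X f : is_path (T X) f <-> (forall z, node X f z) /\ f root = 0.
  rewrite /is_path /T /= /seq_size /seq_nth; split=> [h|[h hroot] n].
    split=> [z|].
      pose n := (z + (npair 0 (p z)./2 + (npair 1 (q z) + (npair 1 (r z) + npair 1 (s z))))).+1.
      have := h n; rewrite CodeSeq.codeK size_mkseq => /andP[/allP/(_ z) hz _]; move: hz.
      have sz : seen n z by rewrite /seen /n; apply/and4P; split; lia.
      have lt_z : z < n by rewrite /n; lia.
      rewrite mem_iota lt_z sz => /(_ isT).
      by case/and4P: sz => ? ? ? ?; rewrite /node /= !nth_mkseq.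
    have := h root.+1; rewrite CodeSeq.codeK size_mkseq => /andP[_].
    by rewrite ltnSn nth_mkseq //= => /eqP.
  rewrite CodeSeq.codeK size_mkseq; apply/andP; split.
    apply/allP => z _; apply/implyP => /and4P[? ? ? ?].
    by have := h z; rewrite /node /= !nth_mkseq.
  by apply/implyP => ?; rewrite nth_mkseq // hroot.
have treeT X : is_tree (T X).
  move=> u v; rewrite /T /= /seq_size /seq_nth !CodeSeq.codeK size_cat.
  have nthE i : i < size u -> nth 0 (u ++ v) i = nth 0 u i by rewrite nth_cat => ->.
  have lt_cat i : i < size u -> i < size u + size v by move=> h; rewrite ltn_addr.
  move=> /andP[/allP ha hroot]; apply/andP; split.
    apply/allP => z; rewrite mem_iota /= => lt_z; apply/implyP => /and4P[h1 h2 h3 h4].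
    have := ha z; rewrite mem_iota /= lt_cat // => /(_ isT).
    by rewrite /seen !lt_cat // /node !nthE.
  by apply/implyP => lt_r; move: hroot; rewrite lt_cat // nthE.
have nodeE X f z : node X f z = rho (npair z (npair
    (chi (join X [set n | f (npair 0 n) = 0]) (p z))
    (npair (f (npair 1 (q z))) (npair (f (npair 1 (r z))) (f (npair 1 (s z))))))).
  rewrite /node; congr (rho (npair _ (npair _ _))); rewrite /chi /join /=.
  by case: ifP => _ //; congr (nat_of_bool _); apply/eqP/asboolP.
have [d hd] : exists d, forall a : set nat * (nat -> nat),
    computes d (join a.1 (graph a.2)) [set n | a.2 (npair 0 n) = 0].
  apply: (proj1 (ucomp_computes _ _)).
  apply: (@ucomp_ext _ _ (fun a n => chi (join a.1 (graph a.2)) (npair (npair 0 n) 0).*2.+1)).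
    by move=> [X f] n; rewrite /chi join_odd /graph /= !npE.
  by uc.
exists c, d => X dX; exists (T X); split=> //.
  split=> //; have [Y /RE hR] := tot X dX; have [w hw] := exK (join X Y).
  pose f x := if nfst x == 0 then ~~ `[< Y (nsnd x) >] : nat else w (nsnd x).
  have fY : [set n | f (npair 0 n) = 0] = Y.
    by rewrite predeqE => n; rewrite /f /= !npE /=; case: asboolP.
  have fw x : f (npair 1 x) = w x by rewrite /f !npE.
  exists f; apply/pathE; split; last by rewrite fw; exact: (proj2 (tab _ _ hw 0) hR).
  by move=> z; rewrite nodeE fY !fw; exact: (proj1 (KE _ _) hw).
move=> _ [f [-> /pathE[hn hroot]]]; exists [set n | f (npair 0 n) = 0].
split; first exact: (hd (X, f)).
apply/RE; apply/(tab _ (f \o npair 1)) => //; apply/KE => z.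
by rewrite -nodeE.
Qed.

(** * Formulas in omega-models *)

Lemma teval_tsubst v s t : teval v (tsubst s t) = teval (fun i => teval v (s i)) t.
Proof. by elim: t => //= [t -> u ->|t -> u ->]. Qed.

Lemma teval_scons_tshift n v (s : nat -> term) :
  (fun i => teval (scons n v) (scons (TVar 0) (tshift \o s) i)) =
  scons n (fun i => teval v (s i)).
Proof. by apply/funext => -[|i] //=; rewrite /tshift teval_tsubst. Qed.

Lemma scons_succ T (x : T) V (r : nat -> nat) :
  (fun i => scons x V (scons 0 (succn \o r) i)) = scons x (fun i => V (r i)).
Proof. by apply/funext => -[|i]. Qed.

Lemma sat_subst S p : forall v V s r,
  sat S v V (subst s r p) <-> sat S (fun i => teval v (s i)) (fun i => V (r i)) p.
Proof.
elim: p => [t u|t u|t X||p IHp q IHq|p IHp q IHq|p IHp q IHq|p IH|p IH|p IH|p IH] v V s r /=.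
- by rewrite !teval_tsubst.
- by rewrite !teval_tsubst.
- by rewrite !teval_tsubst.
- by [].
- by rewrite IHp IHq.
- by rewrite IHp IHq.
- by rewrite IHp IHq.
- by split=> h n; move: (h n); rewrite IH teval_scons_tshift.
- by split=> -[n h]; exists n; move: h; rewrite IH teval_scons_tshift.
- by split=> h X SX; move: (h X SX); rewrite IH scons_succ.
- by split=> -[X [SX h]]; exists X; split=> //; move: h; rewrite IH scons_succ.
Qed.

Lemma sat_shiftN S v V n p : sat S (scons n v) V (shiftN p) <-> sat S v V p.
Proof. by rewrite /shiftN sat_subst. Qed.

Lemma sat_shiftS S v V X p : sat S v (scons X V) (shiftS p) <-> sat S v V p.
Proof. by rewrite /shiftS sat_subst. Qed.

Lemma sat_instN S v V t p : sat S v V (instN t p) <-> sat S (scons (teval v t) v) V p.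
Proof.
rewrite /instN sat_subst; suff -> : (fun i => teval v (scons t TVar i)) = scons (teval v t) v by [].
by apply/funext => -[|i].
Qed.

Lemma sat_instS S v V X p : sat S v V (instS X p) <-> sat S v (scons (V X) V) p.
Proof.
rewrite /instS sat_subst; suff -> : (fun i => V (scons X id i)) = scons (V X) V by [].
by apply/funext => -[|i].
Qed.

Lemma derives_sound G p : derives G p -> forall S v V, (forall i, S (V i)) ->
  (forall q, List.In q G -> sat S v V q) -> sat S v V p.
Proof.
have cons_hyp S v V q G0 : sat S v V q -> (forall p, List.In p G0 -> sat S v V p) ->
  forall p, List.In p (q :: G0) -> sat S v V p by move=> hq hG p' [<-|/hG].
have SV_scons (S : set (set nat)) V X : S X -> (forall i, S (V i)) -> forall i, S (scons X V i).
  by move=> SX SV [|i] /=.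
have shN S v V n G0 : (forall p, List.In p G0 -> sat S v V p) ->
    forall p, List.In p (map shiftN G0) -> sat S (scons n v) V p.
  by move=> h p' /List.in_map_iff[q [<- /h]]; rewrite sat_shiftN.
have shS S v V X G0 : (forall p, List.In p G0 -> sat S v V p) ->
    forall p, List.In p (map shiftS G0) -> sat S v (scons X V) p.
  by move=> h p' /List.in_map_iff[q [<- /h]]; rewrite sat_shiftS.
elim=> {G p} /=.
- by move=> G p inG S v V _; apply.
- move=> G p _ IH S v V SV hG; apply: contrapT => np.
  by apply: (IH S v V) => //; exact: cons_hyp.
- by move=> G p q _ IH S v V SV hG hp; apply: IH => //; exact: cons_hyp.
- by move=> G p q _ IH1 _ IH2 S v V SV hG; apply: (IH1 S v V) => //; exact: IH2.
- by move=> G p q _ IH1 _ IH2 S v V SV hG; split; [exact: IH1|exact: IH2].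
- by move=> G p q _ IH S v V SV hG; case: (IH S v V SV hG).
- by move=> G p q _ IH S v V SV hG; case: (IH S v V SV hG).
- by move=> G p q _ IH S v V SV hG; left; exact: IH.
- by move=> G p q _ IH S v V SV hG; right; exact: IH.
- move=> G p q r _ IH _ IH1 _ IH2 S v V SV hG; have [h|h] := IH S v V SV hG.
    by apply: IH1 => //; exact: cons_hyp.
  by apply: IH2 => //; exact: cons_hyp.
- by move=> G p _ IH S v V SV hG n; apply: IH => //; exact: shN.
- by move=> G p t _ IH S v V SV hG; rewrite sat_instN; exact: IH.
- by move=> G p t _ IH S v V SV hG; exists (teval v t); rewrite -sat_instN; exact: IH.
- move=> G p q _ IH1 _ IH2 S v V SV hG; have [n hn] := IH1 S v V SV hG.
  by rewrite -(sat_shiftN S v V n); apply: IH2 => //; apply: cons_hyp => //; exact: shN.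
- by move=> G p _ IH S v V SV hG X SX; apply: IH; [exact: SV_scons|exact: shS].
- by move=> G p X _ IH S v V SV hG; rewrite sat_instS; apply: IH.
- by move=> G p X _ IH S v V SV hG; exists (V X); split=> //; rewrite -sat_instS; exact: IH.
- move=> G p q _ IH1 _ IH2 S v V SV hG; have [X [SX hX]] := IH1 S v V SV hG.
  rewrite -(sat_shiftS S v V X); apply: IH2; first exact: SV_scons.
  by apply: cons_hyp => //; exact: shS.
- by [].
- move=> G p s t _ IH1 _ IH2 S v V SV hG; have := IH2 S v V SV hG.
  by rewrite !sat_instN; have /= -> := IH1 S v V SV hG.
Qed.

Lemma proves_sound T p S : proves T p -> (forall q, T q -> models S q) -> models S p.
Proof.
move=> [G [GT hd]] hT v V SV; exact: (derives_sound hd SV (fun q qG => hT q (GT q qG) v V SV)).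
Qed.

Lemma teval_bound a t v v' : term_bound a t -> (forall i, i < a -> v i = v' i) ->
  teval v t = teval v' t.
Proof.
move=> + e; elim: t => //= [t IHt u IHu [/IHt-> /IHu->]//|t IHt u IHu [/IHt-> /IHu->]//].
Qed.

Lemma sat_bound S p : forall a b v v' V V', free_bound a b p ->
  (forall i, i < a -> v i = v' i) -> (forall i, i < b -> V i = V' i) ->
  sat S v V p <-> sat S v' V' p.
Proof.
have sc T (x : T) a f f' : (forall i, i < a -> f i = f' i) ->
    forall i, i < a.+1 -> scons x f i = scons x f' i by move=> h [|i] //=; exact: h.
elim: p => [t u|t u|t X||p IHp q IHq|p IHp q IHq|p IHp q IHq|p IH|p IH|p IH|p IH]
  a b v v' V V' /=.
- by move=> [ht hu] hv hV; rewrite (teval_bound ht hv) (teval_bound hu hv).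
- by move=> [ht hu] hv hV; rewrite (teval_bound ht hv) (teval_bound hu hv).
- by move=> [ht hX] hv hV; rewrite (teval_bound ht hv) hV.
- by [].
- by move=> [hp hq] hv hV; rewrite (IHp _ _ _ _ _ _ hp hv hV) (IHq _ _ _ _ _ _ hq hv hV).
- by move=> [hp hq] hv hV; rewrite (IHp _ _ _ _ _ _ hp hv hV) (IHq _ _ _ _ _ _ hq hv hV).
- by move=> [hp hq] hv hV; rewrite (IHp _ _ _ _ _ _ hp hv hV) (IHq _ _ _ _ _ _ hq hv hV).
- move=> hp hv hV; split=> h n; have := h n;
    by rewrite (IH _ _ _ _ _ _ hp (sc _ n _ _ _ hv) hV).
- move=> hp hv hV; split=> -[n h]; exists n; move: h;
    by rewrite (IH _ _ _ _ _ _ hp (sc _ n _ _ _ hv) hV).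
- move=> hp hv hV; split=> h X SX; have := h X SX;
    by rewrite (IH _ _ _ _ _ _ hp hv (sc _ X _ _ _ hV)).
- move=> hp hv hV; split=> -[X [SX h]]; exists X; split=> //; move: h;
    by rewrite (IH _ _ _ _ _ _ hp hv (sc _ X _ _ _ hV)).
Qed.

Lemma ex_free_bound p : exists a b, free_bound a b p.
Proof.
have tmono a a' t : a <= a' -> term_bound a t -> term_bound a' t.
  move=> le_a; elim: t => //= [i /leq_trans->//|t IHt u IHu [/IHt ? /IHu ?]//|t IHt u IHu [/IHt ? /IHu ?]//].
have mono q : forall a a' b b', a <= a' -> b <= b' -> free_bound a b q -> free_bound a' b' q.
  elim: q => [t u|t u|t X||q IHq r IHr|q IHq r IHr|q IHq r IHr|q IH|q IH|q IH|q IH] a a' b b' la lb /=.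
  - by move=> [/(tmono _ _ _ la) ? /(tmono _ _ _ la) ?].
  - by move=> [/(tmono _ _ _ la) ? /(tmono _ _ _ la) ?].
  - by move=> [/(tmono _ _ _ la) ? /leq_trans->].
  - by [].
  - by move=> [/(IHq _ _ _ _ la lb) ? /(IHr _ _ _ _ la lb) ?].
  - by move=> [/(IHq _ _ _ _ la lb) ? /(IHr _ _ _ _ la lb) ?].
  - by move=> [/(IHq _ _ _ _ la lb) ? /(IHr _ _ _ _ la lb) ?].
  - exact: IH.
  - exact: IH.
  - exact: IH.
  - exact: IH.
have tex t : exists a, term_bound a t.
  elim: t => [i|||t [a ha] u [a' ha']|t [a ha] u [a' ha']] /=; try by exists 0.
  - by exists i.+1.
  - by exists (maxn a a'); split; [apply: tmono ha|apply: tmono ha']; rewrite ?leq_maxl ?leq_maxr.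
  - by exists (maxn a a'); split; [apply: tmono ha|apply: tmono ha']; rewrite ?leq_maxl ?leq_maxr.
have two (P Q : nat -> nat -> Prop) :
    (forall a a' b b', a <= a' -> b <= b' -> P a b -> P a' b') ->
    (forall a a' b b', a <= a' -> b <= b' -> Q a b -> Q a' b') ->
    (exists a b, P a b) -> (exists a b, Q a b) -> exists a b, P a b /\ Q a b.
  move=> mP mQ [a [b hP]] [a' [b' hQ]]; exists (maxn a a'), (maxn b b').
  by split; [apply: mP hP|apply: mQ hQ]; rewrite ?leq_maxl ?leq_maxr.
elim: p => [t u|t u|t X||p IHp q IHq|p IHp q IHq|p IHp q IHq|p [a [b h]]|p [a [b h]]|p [a [b h]]|p [a [b h]]] /=.
- have [a ha] := tex t; have [a' ha'] := tex u.
  by exists (maxn a a'), 0; split; [apply: tmono ha|apply: tmono ha']; rewrite ?leq_maxl ?leq_maxr.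
- have [a ha] := tex t; have [a' ha'] := tex u.
  by exists (maxn a a'), 0; split; [apply: tmono ha|apply: tmono ha']; rewrite ?leq_maxl ?leq_maxr.
- by have [a ha] := tex t; exists a, X.+1.
- by exists 0, 0.
- exact: (two _ _ (mono p) (mono q) IHp IHq).
- exact: (two _ _ (mono p) (mono q) IHp IHq).
- exact: (two _ _ (mono p) (mono q) IHp IHq).
- by exists a, b; apply: mono h.
- by exists a, b; apply: mono h.
- by exists a, b; apply: mono h.
- by exists a, b; apply: mono h.
Qed.

Lemma sat_arithmetical S S' p : arithmetical p ->
  forall v V, sat S v V p <-> sat S' v V p.
Proof.
elim: p => //= [p IHp q IHq|p IHp q IHq|p IHp q IHq|p IH|p IH].
- by move=> [/IHp hp /IHq hq] v V; rewrite hp hq.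
- by move=> [/IHp hp /IHq hq] v V; rewrite hp hq.
- by move=> [/IHp hp /IHq hq] v V; rewrite hp hq.
- by move=> /IH h v V; split=> H n; apply/h.
- by move=> /IH h v V; split=> -[n H]; exists n; apply/h.
Qed.

(** Fewer sets make universal set quantifiers easier to satisfy. *)
Lemma sat_Pi11_down S p : Pi11 p -> forall v V, sat setT v V p -> sat S v V p.
Proof.
elim=> {p} [p ap|p _ IH] v V; first by rewrite (sat_arithmetical S setT ap).
by move=> /= h X _; apply: IH; exact: h.
Qed.

(** Assignments as the arguments of an arithmetical predicate: [num_env n] lists the
    components of the iterated pair [n], and [set_env A] those of the iterated join
    [A].  They realize any prescribed values of finitely many variables. *)
Definition num_env (n i : nat) : nat := nfst (iter i nsnd n).
Fixpoint set_place (i n : nat) : nat := if i is i'.+1 then (set_place i' n).*2.+1 else n.*2.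
Definition set_env (A : set nat) (i : nat) : set nat := [set n | A (set_place i n)].

Lemma num_env_scons k n : num_env (npair k n) = scons k (num_env n).
Proof. by apply/funext => -[|i]; rewrite /num_env ?iterSr /= npE. Qed.

Lemma set_env0 X Y : set_env (join X Y) 0 = X.
Proof. by rewrite predeqE => n; rewrite /set_env /= join_even. Qed.

Lemma set_envS X Y i : set_env (join X Y) i.+1 = set_env Y i.
Proof. by rewrite predeqE => n; rewrite /set_env /= join_odd. Qed.

Lemma ex_num_env (v : nat -> nat) a : exists w, forall i, i < a -> num_env w i = v i.
Proof.
elim: a v => [|a IH] v; first by exists 0.
have [w hw] := IH (v \o succn); exists (npair (v 0) w); rewrite num_env_scons => -[|i] //=; exact: hw.
Qed.

Lemma computable_teval t : computable (fun n => teval (num_env n) t).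
Proof.
elim: t => [i|||t IHt u IHu|t IHt u IHu] /=; try by ucc.
rewrite /computable; apply: ucomp_fst; elim: i => [|i IH]; first exact: ucomp_id.
by apply: ucomp_snd.
Qed.

Lemma arith_formula p : arithmetical p ->
  arith (fun A n => sat setT (num_env n) (set_env A) p).
Proof.
have ht := computable_teval.
elim: p => //= [t u _|t u _|t X _|_|p IHp q IHq [/IHp ? /IHq ?]|p IHp q IHq [/IHp ? /IHq ?]
  |p IHp q IHq [/IHp ? /IHq ?]|p IH /IH h|p IH /IH h].
- by apply: arith_eq.
- by apply: arith_bool; exact: (ucomp_leq (ucomp_succ (ht t)) (ht u)).
- apply: (arith_mem (h := fun n => set_place X (teval (num_env n) t))).
  rewrite /computable; elim: X => [|X IH] /=; first exact: (ucomp_double (ht t)).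
  exact: (ucomp_succ (ucomp_double IH)).
- exact: arith_false.
- exact: arith_imp.
- exact: arith_and.
- exact: arith_or.
- apply: arith_all; apply: arith_ext h _ => A z; by rewrite -num_env_scons npE.
- apply: arith_ex; apply: arith_ext h _ => A z; by rewrite -num_env_scons npE.
Qed.

Lemma Delta00_arithmetical p : Delta00 p -> arithmetical p.
Proof. by elim=> //=. Qed.

Lemma Sigma01_arithmetical p : Sigma01 p -> arithmetical p.
Proof. by case=> q /Delta00_arithmetical. Qed.

(** ** Effective models closed under a problem *)

Definition members (m : emodel) : set (set nat) := [set X | exists i, m i = X].

Lemma ex_set_env (m : emodel) (V : nat -> set nat) b : (forall i, members m (V i)) ->
  exists k, forall i, i < b -> set_env (m k) i = V i.
Proof.
elim: b V => [|b IH] V hV; first by exists 0.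
have [k hk] := IH (V \o succn) (fun i => hV i.+1); have [j hj] := hV 0.
exists (em_g m j k); rewrite em_join => -[|i] lt_i; first by rewrite set_env0.
by rewrite set_envS hk.
Qed.

(** The members of an effective model satisfy arithmetical comprehension, by
    deciding the formula from a jump of the join of its set parameters. *)
Lemma members_arithmetical (m : emodel) p v V : arithmetical p ->
  (forall i, members m (V i)) -> members m [set n | sat (members m) (scons n v) V p].
Proof.
move=> ap hV; have [a [b fp]] := ex_free_bound p.
have [k hk] := ex_set_env b hV; have [w hw] := ex_num_env v a.
have hc : computable (fun n => npair n w) by ucc.
have [j ej] := em_comprehension m k (arith_reindex (arith_formula ap) hc).
exists j; rewrite ej predeqE => n /=; rewrite num_env_scons.
rewrite (sat_arithmetical setT (members m) ap).
apply: (sat_bound _ fp) => // -[|i] //= lt_i; apply: hw; exact: ltnW.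
Qed.

Lemma members_RCA0 (m : emodel) p : RCA0 p -> models (members m) p.
Proof.
case=> {p} [||||||||p hp|p q hp hq] v V hV /=.
- by rewrite addn1.
- by rewrite !addn1 => -[].
- by rewrite addn0.
- by rewrite addnA.
- by rewrite muln0.
- by rewrite mulnDr muln1.
- by [].
- by rewrite addn1 ltnS leq_eqVlt; split=> [/orP[/eqP|]|[->|/eqP->]]; rewrite ?orbT; auto.
- move=> [/sat_instN h0 hS] n; elim: n => [//|n /hS].
  rewrite sat_subst; suff -> : (fun i => teval (scons n v)
    (scons (FSucc (TVar 0)) (fun i => TVar i.+1) i)) = scons n.+1 v by [].
  by apply/funext => -[|i] //=; rewrite addn1.
- move=> _; exists [set n | sat (members m) (scons n v) V p]; split.
    by apply: members_arithmetical => //; exact: Sigma01_arithmetical.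
  by move=> n; split; rewrite sat_shiftS.
Qed.

(** In a model closed under [ATR2], the alternative output, a descending sequence, is
    excluded for the orders that are well-orders in the model. *)
Lemma members_ATR0 (m : emodel) :
  (forall i, dom ATR2 (m i) -> exists j, out ATR2 (m i) (m j)) ->
  omega_model_ATR0 (members m).
Proof.
move=> refl; split; first by exists (m 0), 0.
  by move=> p; exact: members_RCA0.
move=> _ _ [i <-] [j <-] [lin nodesc].
have [|k] := refl (em_g m i j); first by rewrite em_join; exists (m i), (m j).
rewrite em_join => -[L [A [/join_inj[<- <-] [hH|[f [ef df]]]]]].
  by exists (m k); split=> //; exists k.
by case: nodesc; exists f; split=> //; exists k; rewrite ef.
Qed.

(** The reflecting model has a member that solves the instance, and the index of the
    first one can be found, because arithmetical properties of members are decided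
    from the code of the model. *)
Lemma le_rfn P : (exists2 R, arith R & forall X Y, out P X Y <-> R (join X Y) 0) ->
  weihrauch_le P (rfn P).
Proof.
move=> [R aR RE].
have [cid hid] : exists c, forall X, computes c X X.
  by exists COracle => X n; split=> ?; [left|right].
pose J := {a : set nat * set nat | dom P a.1 /\ rfn_out P a.1 a.2}.
have [|m hm] := @choice J emodel (fun a m => (sval a).2 = em_code m /\
    (exists j, out P (sval a).1 (m j)) /\ m (em_e m) = (sval a).1).
  move=> [[X Y] /= [dX [M [f [g [e [-> hM eX refl]]]]]]].
  by exists (EModel e hM); split=> //; split=> //=; rewrite -eX; apply: refl; rewrite eX.
pose O (a : J) := join (sval a).1 (sval a).2.
have m_comp : ucomp O (fun a => chi (em_code (m a))).
  have [c hc] := computes_right; exists c => a; apply/computesP.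
  by have [<- _] := hm a; exact: hc.
have [|sol hsol] := @choice J nat (fun a j => R (m a (em_g (m a) (em_e (m a)) j)) 0 /\
    forall k, k < j -> ~ R (m a (em_g (m a) (em_e (m a)) k)) 0).
  move=> a; have [_ [[j oj] ea]] := hm a.
  pose b k := `[< R (m a (em_g (m a) (em_e (m a)) k)) 0 >].
  have exb : exists k, b k by exists j; apply/asboolP; rewrite em_join ea; apply/RE.
  case: (ex_minnP exb) => k /asboolP bk kmin; exists k; split=> // l lt_l /asboolP /kmin.
  by rewrite leqNgt lt_l.
have sol_comp : ucomp O (fun a _ => sol a).
  apply: (@ucomp_mu _ _ (fun a _ j => ~~ `[< R (m a (em_g (m a) (em_e (m a)) j)) 0 >])).
  - apply: ucomp_negb; have h := ucomp_em_arith m_comp aR.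
    have hj : ucomp O (fun a z => em_g (m a) (em_e (m a)) (nsnd z)).
      apply: (ucomp_app2 (H := fun a => em_g (m a)) (ucomp_em_g m_comp)); last by uc.
      exact: ucomp_em_e.
    have := ucomp_app h (ucomp_pair hj (@ucomp_const _ _ 0)).
    by apply: ucomp_ext => a z; rewrite !npE.
  - by move=> a _; have [h _] := hsol a; rewrite asboolT.
  - by move=> a _ j lt_j; have [_ /(_ _ lt_j) h] := hsol a; rewrite asboolF.
have [d hd] : exists d, forall a : J, computes d (O a) (m a (sol a)).
  apply/ucomp_computes.
  have := ucomp_app (ucomp_em_set m_comp) (ucomp_pair sol_comp (@ucomp_id _ _)).
  by apply: ucomp_ext => a n; rewrite !npE.
exists cid, d => X dX; exists X; split=> // Y oY.
pose a : J := exist _ (X, Y) (conj dX oY).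
exists (m a (sol a)); split; first exact: (hd a).
have [_ [_ ea]] := hm a; have [/= h _] := hsol a.
by apply/RE; rewrite -[X]ea -em_join.
Qed.

(** The join is rearranged so that Y and X become the set variables 0 and 1 of
    [eta]. *)
Lemma Pb_arith_out theta eta (h : representation theta eta) : arithmetical eta ->
  exists2 R, arith R & forall X Y, out (Pb h) X Y <-> R (join X Y) 0.
Proof.
move=> aeta.
pose Q (A : set nat) (_ : nat) := join [set n | A n.*2.+1] (join [set n | A n.*2] [set n | A n.*2]).
exists (fun A n => sat setT (num_env n) (set_env (Q A n)) eta).
  apply: (arith_in (arith_formula aeta)); last by ucc.
  by rewrite /Q /join; ar.
move=> X Y; rewrite /= /repr_out /=.
have -> : Q (join X Y) 0 = join Y (join X X).
  rewrite /Q; congr (join _ _); first by rewrite predeqE => n; rewrite /= join_odd.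
  by congr (join _ _); rewrite predeqE => n; rewrite /= join_even.
apply: (sat_bound _ (eta_free h)) => // -[|[|//]] _ /=; by rewrite ?set_envS set_env0.
Qed.

(** An output for [rfn ATR2] is itself an output for [rfn (Pb h)]: its model satisfies
    the sentence, the hypothesis [theta] of an instance persists from the full
    structure to the model, and the arithmetical conclusion [eta] is absolute. *)
Lemma rfn_Pb_le theta eta (h : representation theta eta) T :
  Pi11 theta -> arithmetical eta ->
  (forall s, T s -> forall S, omega_model_ATR0 S -> models S s) ->
  proves T (L2_sentence theta eta) ->
  weihrauch_le (rfn (Pb h)) (rfn ATR2).
Proof.
move=> pith aeta hT prov.
have [d hd] := computes_right.
exists COracle, d => X _; exists X; split=> //; first by split=> ?; [left|right].
move=> Y [M [f [g [e [-> hM eX refl]]]]]; exists (tuple4 M f g e); split; first exact: hd.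
exists M, f, g, e; split=> // i di.
pose m := EModel e hM.
have mods := proves_sound prov (fun q Tq => hT q Tq _ (@members_ATR0 m refl)).
have := mods (fun=> 0) (fun=> M 0) (fun=> ex_intro _ 0 erefl) (M i) (ex_intro _ i erefl).
have hth : sat (members m) (fun=> 0) (scons (M i) (fun=> M 0)) theta.
  apply/(sat_bound _ (theta_free h) (v' := fun=> 0) (V' := scons (M i) (fun=> set0))) => //.
    by case.
  exact: sat_Pi11_down.
move=> /(_ hth)[_ [[j <-] hj]]; exists j; rewrite /= /repr_out /=.
rewrite -(sat_arithmetical (members m) setT aeta).
by apply: (proj1 (sat_bound _ (eta_free h) _ _) hj) => // -[|[|]].
Qed.

(** * The theorem *)

Lemma weihrauch_le_trans P Q R : weihrauch_le P Q -> weihrauch_le Q R -> weihrauch_le P R.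
Proof.
move=> [c [d h]] [c' [d' h']].
have [l hl] := computes_left; have [r hr] := computes_right.
have [e he] := computes_join (csub c l) r.
have [e' he'] := computes_join l (csub d' e).
exists (csub c' c), (csub d e') => X /h[Z [cZ /h'[Z' [cZ' dZ' hZ']] hZ]].
exists Z'; split=> //; first exact: csubP cZ cZ'.
move=> Y /hZ'[V [dV /hZ[W [dW oW]]]]; exists W; split=> //.
apply: csubP dW; apply: he'; first exact: hl.
by apply: csubP dV; apply: he; [apply: csubP (hl _ _) cZ|exact: hr].
Qed.

Theorem theorem4p20 :
  (forall (theta eta : formula) (h : representation theta eta),
     Pi11 theta -> arithmetical eta ->
     (exists T : set formula,
        (forall s, T s ->
           sentence s /\ forall S, omega_model_ATR0 S -> models S s) /\
        proves T (L2_sentence theta eta)) ->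
     weihrauch_le (Pb h) (rfn (Pb h)) /\
     weihrauch_le (rfn (Pb h)) (rfn ATR2)) /\
  weihrauch_lt (rfn ATR2) CBaire.
Proof.
split.
  move=> theta eta h pith aeta [T [hT prov]]; split.
    by apply: le_rfn; exact: Pb_arith_out.
  by apply: (rfn_Pb_le h pith aeta _ prov) => s /hT[].
have aR := arith_rfn arith_ATR2; have tR := rfn_total ATR2_total.
split; first exact: arith_problem_le_CBaire.
move=> le; apply: (rfn_not_le aR tR).
exact: weihrauch_le_trans (arith_problem_le_CBaire (arith_rfn aR) (rfn_total tR)) le.
Qed.
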